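(* Let $n\ge 3$ and let $s\in\mathbb{R}$. Suppose that there is a constant $C_s<\infty$ such that $$\Big\|\sup_{0<t<1}\big|e^{it\Delta}f\big|\Big\|_{L^2(B(0,1))}\le C_s\|f\|_{H^s(\mathbb{R}^n)}$$ for every Schwartz function $f$ on $\mathbb{R}^n$, where $B(0,1)$ is the unit ball of $\mathbb{R}^n$ centred at the origin. Then $s\ge\frac{n}{2(n+2)}$.
   Context: For a Schwartz function $f$ on $\mathbb{R}^n$, with Fourier transform $\widehat f(\xi)=\int_{\mathbb{R}^n} f(x)e^{-2\pi i x\cdot\xi}\,dx$, $$e^{it\Delta}f(x)=\int_{\mathbb{R}^n}\widehat{f}(\xi)\,e^{2\pi i x\cdot\xi-4\pi^2 i t|\xi|^2}\,d\xi .$$ $H^s(\mathbb{R}^n)$ is the inhomogeneous $L^2$-Sobolev space, with norm $\|f\|_{H^s}=\|(1+|\xi|^2)^{s/2}\widehat f(\xi)\|_{L^2(\mathbb{R}^n)}$. *)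

(* Defs.v *)
From HB Require Import structures.
From mathcomp Require Import all_boot all_order all_algebra.
From mathcomp Require Import complex.
From mathcomp Require Import all_classical all_reals all_analysis.

Set Implicit Arguments.
Unset Strict Implicit.
Unset Printing Implicit Defensive.

Import Order.TTheory GRing.Theory Num.Theory.
Import ComplexField.
Import numFieldNormedType.Exports.

Local Open Scope classical_set_scope.
Local Open Scope ring_scope.
Local Open Scope complex_scope.

(* R^n is 'rV[R]_n. As for n.-tuple R in the library, its sigma-algebra is the
   one generated by the coordinates, i.e. the Borel sigma-algebra. *)
Definition rV_coord (R : realType) n (i : 'I_n) (x : 'rV[R]_n) : R := x ord0 i.

Fact rV_display : measure_display.
Proof. exact: default_measure_display. Qed.

Fact rV_measurable_set0 (R : realType) n :
  g_sigma_preimage (@rV_coord R n) set0.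
Proof. exact: sigma_algebra0. Qed.

Fact rV_measurable_setC (R : realType) n A :
  g_sigma_preimage (@rV_coord R n) A -> g_sigma_preimage (@rV_coord R n) (~` A).
Proof. exact: sigma_algebraC. Qed.

Fact rV_measurable_bigcup (R : realType) n (F : (set 'rV[R]_n)^nat) :
  (forall i, g_sigma_preimage (@rV_coord R n) (F i)) ->
  g_sigma_preimage (@rV_coord R n) (\bigcup_i F i).
Proof. exact: sigma_algebra_bigcup. Qed.

HB.instance Definition _ (R : realType) n :=
  @isMeasurable.Build rV_display 'rV[R]_n (g_sigma_preimage (@rV_coord R n))
    (@rV_measurable_set0 R n) (@rV_measurable_setC R n)
    (@rV_measurable_bigcup R n).

Lemma measurable_rV_coord (R : realType) n (i : 'I_n) :
  measurable_fun setT (@rV_coord R n i).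
Proof.
move=> _ Y mY; rewrite setTI; apply: sub_sigma_algebra.
rewrite -bigcup_seq/=; exists i => /=; first by rewrite mem_index_enum.
by exists Y => //; rewrite setTI.
Qed.

Lemma measurable_fun_rVP d (T : measurableType d) (R : realType) n
    (f : T -> 'rV[R]_n) :
  (forall i, measurable_fun setT (fun x => f x ord0 i)) ->
  measurable_fun setT f.
Proof.
move=> mf.
have H : g_sigma_preimage (fun i => @rV_coord R n i \o f) `<=` measurable.
  apply: smallest_sub; first exact: sigma_algebra_measurable.
  move=> A; rewrite -bigcup_seq /= => -[i _ [B mB <-]].
  exact: mf.
by rewrite g_sigma_preimage_comp in H => _ A mA; apply: H; exists A.
Qed.

Definition rV_cons (R : realType) n (p : R * 'rV[R]_n) : 'rV[R]_n.+1 :=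
  \row_i oapp (fun j => p.2 ord0 j) p.1 (unlift ord0 i).

Definition rV_uncons (R : realType) n (x : 'rV[R]_n.+1) : R * 'rV[R]_n :=
  (x ord0 ord0, \row_i x ord0 (lift ord0 i)).

Lemma rV_cons0 (R : realType) n (p : R * 'rV[R]_n) :
  rV_cons p ord0 ord0 = p.1.
Proof. by rewrite mxE unlift_none. Qed.

Lemma rV_consS (R : realType) n (p : R * 'rV[R]_n) i :
  rV_cons p ord0 (lift ord0 i) = p.2 ord0 i.
Proof. by rewrite mxE liftK. Qed.

Lemma rV_consK (R : realType) n : cancel (@rV_cons R n) (@rV_uncons R n).
Proof.
move=> [a x]; rewrite /rV_uncons rV_cons0; congr pair.
by apply/rowP => i; rewrite mxE rV_consS.
Qed.

Lemma rV_unconsK (R : realType) n : cancel (@rV_uncons R n) (@rV_cons R n).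
Proof.
move=> x; apply/rowP => i; have [j ->|->] := unliftP ord0 i.
  by rewrite rV_consS mxE.
by rewrite rV_cons0.
Qed.

Lemma measurable_rV_cons (R : realType) n :
  measurable_fun setT (@rV_cons R n).
Proof.
apply: measurable_fun_rVP => i; have [j ->|->] := unliftP ord0 i.
  under eq_fun do rewrite rV_consS.
  exact: (measurableT_comp (measurable_rV_coord j) measurable_snd).
under eq_fun do rewrite rV_cons0.
exact: measurable_fst.
Qed.

Lemma measurable_rV_uncons (R : realType) n :
  measurable_fun setT (@rV_uncons R n).
Proof.
apply/measurable_fun_pairP; split; first exact: measurable_rV_coord.
apply: measurable_fun_rVP => i /=.
under eq_fun do rewrite mxE.
exact: measurable_rV_coord.
Qed.

(* Lebesgue measure on R^(n+1), as the image of the product of the Lebesgue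
   measures on R and R^n; lebesgue_rV_box below gives its value on boxes. *)
Definition lebesgue_rV_step (R : realType) n
    (mu : {sigma_finite_measure set 'rV[R]_n -> \bar R}) :
    set 'rV[R]_n.+1 -> \bar R :=
  pushforward (@lebesgue_measure R \x mu)%E (@rV_cons R n).

Fact lebesgue_rV_step0 (R : realType) n
    (mu : {sigma_finite_measure set 'rV[R]_n -> \bar R}) :
  lebesgue_rV_step mu set0 = 0%E.
Proof. by rewrite /lebesgue_rV_step /pushforward preimage_set0 measure0. Qed.

Fact lebesgue_rV_step_ge0 (R : realType) n
    (mu : {sigma_finite_measure set 'rV[R]_n -> \bar R}) A :
  (0 <= lebesgue_rV_step mu A)%E.
Proof. exact: (measure_ge0 (@lebesgue_measure R \x mu)%E). Qed.

Fact lebesgue_rV_step_sigma_additive (R : realType) n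
    (mu : {sigma_finite_measure set 'rV[R]_n -> \bar R}) :
  semi_sigma_additive (lebesgue_rV_step mu).
Proof.
apply: (@measure_semi_sigma_additive _ _ _
  (pushforward (@lebesgue_measure R \x mu)%E (@rV_cons R n))).
exact: measurable_rV_cons.
Qed.

HB.instance Definition _ (R : realType) n
    (mu : {sigma_finite_measure set 'rV[R]_n -> \bar R}) :=
  isMeasure.Build _ _ _ (lebesgue_rV_step mu) (lebesgue_rV_step0 mu)
    (lebesgue_rV_step_ge0 mu) (@lebesgue_rV_step_sigma_additive R n mu).

Fact lebesgue_rV_step_sigma_finite (R : realType) n
    (mu : {sigma_finite_measure set 'rV[R]_n -> \bar R}) :
  sigma_finite setT (lebesgue_rV_step mu).
Proof.
have /sigma_finiteP[F [TF ndF Foo]] := sigma_finiteT (@lebesgue_measure R).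
have /sigma_finiteP[G [TG ndG Goo]] := sigma_finiteT mu.
exists (fun k => @rV_uncons R n @^-1` (F k `*` G k)).
  apply/seteqP; split => // x _.
  have [i _ Fx] : (\bigcup_i F i) (rV_uncons x).1 by rewrite -TF.
  have [j _ Gx] : (\bigcup_i G i) (rV_uncons x).2 by rewrite -TG.
  exists (maxn i j) => //; split.
  - by move: Fx; exact/subsetPset/ndF/leq_maxl.
  - by move: Gx; exact/subsetPset/ndG/leq_maxr.
move=> k; have [mF Fk] := Foo k; have [mG Gk] := Goo k; split.
  rewrite -[X in measurable X]setTI.
  by apply: measurable_rV_uncons => //; exact: measurableX.
rewrite /lebesgue_rV_step /pushforward -comp_preimage.
rewrite (_ : _ \o _ = id); last by apply/funext => p /=; rewrite rV_consK.
by rewrite preimage_id product_measure1E// lte_mul_pinfty// ge0_fin_numE.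
Qed.

HB.instance Definition _ (R : realType) n
    (mu : {sigma_finite_measure set 'rV[R]_n -> \bar R}) :=
  @Measure_isSigmaFinite.Build _ _ _ (lebesgue_rV_step mu)
    (@lebesgue_rV_step_sigma_finite R n mu).

Fixpoint lebesgue_rV (R : realType) n :
    {sigma_finite_measure set 'rV[R]_n -> \bar R} :=
  match n with
  | 0 => dirac (0 : 'rV[R]_0)
  | m.+1 => lebesgue_rV_step (lebesgue_rV R m)
  end.

Lemma lebesgue_rV_box (R : realType) n (A : 'I_n -> set R) :
  (forall i, measurable (A i)) ->
  lebesgue_rV R n [set x : 'rV[R]_n | forall i, A i (x ord0 i)] =
  (\prod_(i < n) lebesgue_measure (A i))%E.
Proof.
elim: n A => [|n IHn] A mA.
  rewrite big_ord0 /= diracE mem_set//.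
  by case.
rewrite big_ord_recl -IHn; last by move=> i; exact: mA.
set B := [set x : 'rV[R]_n | forall i, A (lift ord0 i) (x ord0 i)].
have -> : lebesgue_rV R n.+1 [set x : 'rV[R]_n.+1 | forall i, A i (x ord0 i)] =
    (@lebesgue_measure R \x lebesgue_rV R n)%E (A ord0 `*` B).
  congr (product_measure1 _ _ _).
  apply/seteqP; split => [[a x] /= Ax|[a x] /= [Aa Bx] i].
    split; first by have := Ax ord0; rewrite rV_cons0.
    by move=> i; have := Ax (lift ord0 i); rewrite rV_consS.
  have [j ->|->] := unliftP ord0 i; first by rewrite rV_consS; exact: Bx.
  by rewrite rV_cons0.
have mB : measurable B.
  have -> : B =
      \bigcap_(i in [set: 'I_n]) (@rV_coord R n i @^-1` A (lift ord0 i)).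
    by apply/seteqP; split => [x Bx i _|x Bx i]; exact: Bx.
  apply: fin_bigcap_measurable => // i _; rewrite -[X in measurable X]setTI.
  exact: measurable_rV_coord.
by rewrite product_measure1E//; exact: mA.
Qed.

(* The library norm on 'rV[R]_n is the sup norm, so the Euclidean norm is
   defined separately. *)
Definition dotmul (R : realType) n (x y : 'rV[R]_n) : R :=
  \sum_i x ord0 i * y ord0 i.

Definition enorm (R : realType) n (x : 'rV[R]_n) : R := Num.sqrt (dotmul x x).

Definition unit_ball (R : realType) n : set 'rV[R]_n := [set x | enorm x < 1].

(* Integrals and derivatives of R[i]-valued functions are taken componentwise:
   the library integral is real-valued and R[i] is not a normed R-module. The
   modulus is Normc.normc, which lies in R, whereas `|z| lies in R[i]. *)
Definition cexpi (R : realType) (theta : R) : R[i] := cos theta +i* sin theta.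

Definition cintegral (R : realType) n (f : 'rV[R]_n -> R[i]) : R[i] :=
  (\int[lebesgue_rV R n]_x complex.Re (f x)) +i*
  (\int[lebesgue_rV R n]_x complex.Im (f x)).

Definition cderivable (R : realType) n (f : 'rV[R]_n -> R[i]) (x v : 'rV[R]_n) :
    Prop :=
  derivable (fun y => complex.Re (f y)) x v /\
  derivable (fun y => complex.Im (f y)) x v.

Definition ccontinuous (R : realType) n (f : 'rV[R]_n -> R[i]) : Prop :=
  continuous (fun x => complex.Re (f x)) /\
  continuous (fun x => complex.Im (f x)).

Definition cpartial (R : realType) n (i : 'I_n) (f : 'rV[R]_n -> R[i])
    (x : 'rV[R]_n) : R[i] :=
  'D_(delta_mx ord0 i) (fun y => complex.Re (f y)) x +i*
  'D_(delta_mx ord0 i) (fun y => complex.Im (f y)) x.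

(* Iterated partial derivatives are indexed by the sequence of directions; on a
   smooth function they depend only on the associated multi-index. *)
Definition cpartials (R : realType) n (b : seq 'I_n) (f : 'rV[R]_n -> R[i]) :
    'rV[R]_n -> R[i] :=
  foldr (@cpartial R n) f b.

Definition smooth (R : realType) n (f : 'rV[R]_n -> R[i]) : Prop :=
  forall b : seq 'I_n,
    ccontinuous (cpartials b f) /\
    forall (i : 'I_n) (x : 'rV[R]_n),
      cderivable (cpartials b f) x (delta_mx ord0 i).

Definition schwartz (R : realType) n (f : 'rV[R]_n -> R[i]) : Prop :=
  smooth f /\
  forall (a : 'I_n -> nat) (b : seq 'I_n), exists M : R, forall x : 'rV[R]_n,
    `|\prod_i x ord0 i ^+ a i| * Normc.normc (cpartials b f x) <= M.

Definition fourier (R : realType) n (f : 'rV[R]_n -> R[i]) (xi : 'rV[R]_n) :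
    R[i] :=
  cintegral (fun x => f x * cexpi (- (2 * pi * dotmul x xi))).

(* e^{it Delta} f *)
Definition schrodinger (R : realType) n (t : R) (f : 'rV[R]_n -> R[i])
    (x : 'rV[R]_n) : R[i] :=
  cintegral (fun xi => fourier f xi *
    cexpi (2 * pi * dotmul x xi - 4 * pi ^+ 2 * t * enorm xi ^+ 2)).

Definition schrodinger_max (R : realType) n (f : 'rV[R]_n -> R[i])
    (x : 'rV[R]_n) : \bar R :=
  ereal_sup [set (Normc.normc (schrodinger t f x))%:E
            | t in [set t : R | 0 < t < 1]].

Definition L2norm_on (R : realType) n (B : set 'rV[R]_n)
    (g : 'rV[R]_n -> \bar R) : \bar R :=
  'N[lebesgue_rV R n]_2%:E[g \_ B]%E.

Definition sobolev_norm (R : realType) n (s : R) (f : 'rV[R]_n -> R[i]) :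
    \bar R :=
  'N[lebesgue_rV R n]_2%:E[(fun xi : 'rV[R]_n =>
    ((1 + enorm xi ^+ 2) `^ (s / 2) * Normc.normc (fourier f xi))%:E)]%E.

(* Main.v *)
(* Put L = 16 m, D = L^(n+1), a_j = L^(-j), and take as initial datum the
   Gaussian e^(-pi |x|^2) times the sum of the characters of frequency
   D (l + a / 2), l in {0, ..., m - 1}^n; everything is a tensor product of
   one-dimensional objects.  At a time with 2 pi t = k / D^2 the phase
   x.xi - (k / D^2) |xi|^2 of the l-th summand equals l.(D x - k a), up to an
   integer and a term independent of l.  The leading base-L digits of the
   coordinates of k a mod 1 are the digits of k, so every D x is within 1 / L of
   k a modulo Z^n for some k in [L^n, 2 L^n[.  For that k the phases agree up to
   1 / 16 and, since t |xi| stays bounded, the Gaussians have not left the ball: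
   the supremum is at least (c m)^n on the whole ball.  On the other side the
   frequencies are separated and at most L^(n+2), so the H^s norm is at most a
   constant times m^(n/2) L^((n+2) s).  Letting m tend to infinity gives
   n / 2 <= (n + 2) s. *)

Require Import Defs.
From mathcomp Require Import all_boot all_order all_algebra.
From mathcomp Require Import complex.
From mathcomp Require Import all_classical all_reals all_analysis.
From mathcomp Require Import measurable_realfun.
From mathcomp Require Import ring lra.

Set Implicit Arguments.
Unset Strict Implicit.
Unset Printing Implicit Defensive.

Import Order.TTheory GRing.Theory Num.Theory.
Import ComplexField.
Import numFieldNormedType.Exports.

Local Open Scope classical_set_scope.
Local Open Scope ring_scope.
Local Open Scope complex_scope.

(** * Integrals of the Gaussian [e^(-pi x^2)] on the line *)

Section gaussian.
Context {R : realType}.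
Local Notation mu := (@lebesgue_measure R).

Definition gau (x : R) : R := expR (- (pi * x ^+ 2)).

Lemma gau_gt0 x : 0 < gau x. Proof. exact: expR_gt0. Qed.

Lemma gau_ge0 x : 0 <= gau x. Proof. exact: expR_ge0. Qed.

Lemma continuous_gau : continuous gau.
Proof.
move=> x; apply: (@continuous_comp _ _ _ (fun x : R => - (pi * x ^+ 2)) expR).
  by apply: cvgN; apply: cvgM; [exact: cvg_cst|exact: exprn_continuous].
exact: continuous_expR.
Qed.

Lemma measurable_gau : measurable_fun setT gau.
Proof. by apply: continuous_measurable_fun; exact: continuous_gau. Qed.

(** The integrand is a multiple of the density of the centred normal law of variance [1 / (2 k)],
    whose total mass is 1. *)
Lemma integrable_expR_sqr (k : R) : 0 < k ->
  mu.-integrable setT (EFin \o (fun x => expR (- (k * x ^+ 2)))) /\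
  Rintegral mu setT (fun x => expR (- (k * x ^+ 2))) = Num.sqrt (pi / k).
Proof.
move=> k0; pose s := Num.sqrt (2 * k)^-1.
have s2 : s ^+ 2 = (2 * k)^-1 by rewrite sqr_sqrtr// invr_ge0 mulr_ge0// ltW.
have s0 : s != 0 by rewrite sqrtr_eq0 -ltNge invr_gt0 mulr_gt0.
have E x : expR (- (k * x ^+ 2)) = Num.sqrt (pi / k) * normal_pdf 0 s x.
  rewrite normal_pdfE // /normal_peak s2 /normal_fun subr0 s2.
  rewrite (_ : (2 * k)^-1 * pi *+ 2 = pi / k); last first.
    by rewrite -mulr_natr; field; rewrite gt_eqF.
  rewrite mulVKf; last first.
    by rewrite sqrtr_eq0 -ltNge divr_gt0 ?pi_gt0.
  congr expR; rewrite -mulr_natr; field.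
  by rewrite gt_eqF.
have -> : (fun x => expR (- (k * x ^+ 2))) =
    (fun x => Num.sqrt (pi / k) * normal_pdf 0 s x) by apply/funext => x.
split.
  have -> : EFin \o (fun x => Num.sqrt (pi / k) * normal_pdf 0 s x) =
     (fun x => (Num.sqrt (pi / k))%:E * (normal_pdf 0 s x)%:E)%E by apply/funext.
  apply: integrableZl => //; exact: integrable_normal_pdf.
rewrite RintegralZl//; last exact: integrable_normal_pdf.
by rewrite /Rintegral integral_normal_pdf mulr1.
Qed.

Lemma integrable_gau : mu.-integrable setT (EFin \o gau).
Proof. by have [] := integrable_expR_sqr (@pi_gt0 R). Qed.

Lemma Rintegral_gau : Rintegral mu setT gau = 1.
Proof.
have [_ ->] := integrable_expR_sqr (@pi_gt0 R).
by rewrite divff ?sqrtr1// gt_eqF// pi_gt0.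
Qed.

(** Follows from [1 + x^2 <= e^(x^2)] and [pi >= 2]. It provides the integrable majorant for weights
    of quadratic growth. *)
Lemma gau_sqr_le x : (1 + x ^+ 2) * gau x <= expR (- (1 * x ^+ 2)).
Proof.
apply: (le_trans (ler_wpM2r (gau_ge0 x) (expR_ge1Dx (x ^+ 2)))).
rewrite -expRD ler_expR.
have := sqr_ge0 x; have := @pi_ge2 R; nra.
Qed.

Lemma integrable_gauM (h : R -> R) (C : R) : measurable_fun setT h ->
  (forall x, `|h x| <= C * (1 + x ^+ 2)) ->
  mu.-integrable setT (EFin \o (fun x => h x * gau x)).
Proof.
move=> mh hC.
apply: (@le_integrable _ _ _ mu _ _ _
   (EFin \o (fun x => C * expR (- (1 * x ^+ 2))))) => //.
- apply/measurable_EFinP; apply: measurable_funM => //; exact: measurable_gau.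
- move=> x _ /=; rewrite lee_fin normrM (ger0_norm (gau_ge0 x)).
  apply: le_trans (ler_norm _).
  apply: le_trans (ler_wpM2r (gau_ge0 x) (hC x)) _.
  rewrite -mulrA ler_wpM2l ?gau_sqr_le//.
  have := le_trans (normr_ge0 _) (hC 0); rewrite expr0n addr0 mulr1.
  by [].
- have -> : EFin \o (fun x : R => C * expR (- (1 * x ^+ 2))) =
     (fun x : R => C%:E * (expR (- (1 * x ^+ 2)))%:E)%E by apply/funext.
  by apply: integrableZl => //; have [] := integrable_expR_sqr (@ltr01 R).
Qed.

(** The fundamental theorem of calculus on [[-n, n]], with dominated convergence as [n] grows. This
    is the form in which integration by parts is used below. *)
Lemma Rintegral_derive0 (h h' : R -> R) :
  (forall x, is_derive x (1 : R) h (h' x)) -> continuous h' ->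
  mu.-integrable setT (EFin \o h') ->
  h (n%:R) @[n --> \oo] --> (0 : R) -> h (- n%:R) @[n --> \oo] --> (0 : R) ->
  Rintegral mu setT h' = 0.
Proof.
move=> dh ch ih hy hNy.
pose I n : set R := `[- n%:R, n%:R]%classic.
have cvI : (\int[mu]_x ((EFin \o h') \_ (I n)) x)%E @[n --> \oo] -->
    (\int[mu]_x (h' x)%:E)%E.
  apply: (@dominated_cvg _ _ _ mu setT measurableT _ _ (fun x => `|h' x|%:E)) => //.
  - move=> n; apply/(measurable_restrictT _ _).1 => //; first exact: measurable_itv.
    by apply/measurable_EFinP; apply: measurable_funTS;
      exact: continuous_measurable_fun.
  - move=> x _; apply: cvg_near_cst.
    near=> n; rewrite patchE mem_set// /I /= in_itv /=.
    by rewrite -ler_norml; near: n; exact: nbhs_infty_ger.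
  - by have := integrable_abse ih.
  - move=> n x _; rewrite patchE; case: ifP => _ //=.
    by rewrite normr0 lee_fin.
have : (h n%:R - h (- n%:R))%:E @[n --> \oo] --> (\int[mu]_x (h' x)%:E)%E.
  (* Passing to [n.+1] makes the interval nondegenerate, as the fundamental theorem requires. *)
  rewrite -cvg_shiftS/=; rewrite -cvg_shiftS/= in cvI.
  apply: cvg_trans cvI; apply: near_eq_cvg; near=> n.
  rewrite -integral_mkcond (@continuous_FTC2 _ h' h)//.
  - by rewrite gtrN.
  - exact: continuous_subspaceT.
  - split=> [x _||].
    + by have [] := dh x.
    + apply: cvg_at_right_filter; apply: differentiable_continuous.
      by apply/derivable1_diffP; have [] := dh (- n.+1%:R).
    + apply: cvg_at_left_filter; apply: differentiable_continuous.
      by apply/derivable1_diffP; have [] := dh (n.+1%:R).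
  - by move=> x _; rewrite derive1E; exact: derive_val.
have : (h n%:R - h (- n%:R))%:E @[n --> \oo] --> (0 - 0)%:E.
  by apply: cvg_EFin; [exact: nearW|apply: cvgB].
move=> c1 c2; have := cvg_unique _ c1 c2.
by rewrite /Rintegral => <- //=; rewrite subr0.
Unshelve. all: end_near. Qed.

End gaussian.

(** * Fourier transform of the Gaussian, and translation of integrals *)

Section gaussian_fourier.
Context {R : realType}.
Local Notation mu := (@lebesgue_measure R).

Lemma is_derive_gau (x : R) : is_derive x 1 gau (- (2 * pi * x) * gau x).
Proof.
rewrite /gau; apply: is_derive_eq.
rewrite /GRing.scale/=; ring.
Qed.

Lemma is_derive_cos_affine (a b x : R) :
  is_derive x 1 (fun x => cos (a * x + b)) (- a * sin (a * x + b)).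
Proof.
apply: is_derive_eq; rewrite /GRing.scale/=; ring.
Qed.

Lemma is_derive_sin_affine (a b x : R) :
  is_derive x 1 (fun x => sin (a * x + b)) (a * cos (a * x + b)).
Proof.
apply: is_derive_eq; rewrite /GRing.scale/=; ring.
Qed.

Lemma continuous_cos_affine (a b : R) : continuous (fun x => cos (a * x + b)).
Proof.
by move=> x; apply: differentiable_continuous; apply/derivable1_diffP;
  have [] := is_derive_cos_affine a b x.
Qed.

Lemma continuous_sin_affine (a b : R) : continuous (fun x => sin (a * x + b)).
Proof.
by move=> x; apply: differentiable_continuous; apply/derivable1_diffP;
  have [] := is_derive_sin_affine a b x.
Qed.

Lemma ler1_sqr (x : R) : `|x| <= 1 + x ^+ 2.
Proof. by rewrite -[x ^+ 2]real_normK ?num_real//; nra. Qed.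

(** Disposes of the boundary terms at [n] and [-n]: since [pi n^2 >= n], the Gaussian there is at
    most [e^(-n)]. *)
Lemma bounded_mul_gau_cvg0 (u g : nat -> R) :
  (forall n, `|u n| <= 1) -> (forall n, `|g n| = n%:R) ->
  u n * gau (g n) @[n --> \oo] --> (0 : R).
Proof.
move=> u1 gn; have e0 : expR (- (n%:R : R)) @[n --> \oo] --> (0 : R).
  exact: (cvg_comp _ (fun x => expR (- x)) cvgr_idn (@cvgr_expR R)).
have eN0 : - expR (- (n%:R : R)) @[n --> \oo] --> (0 : R).
  by rewrite -oppr0; exact: cvgN.
apply: (squeeze_cvgr _ eN0 e0); apply: nearW => n.
rewrite -ler_norml normrM (ger0_norm (gau_ge0 _)).
apply: le_trans (ler_piMl (gau_ge0 _) (u1 n)) _.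
rewrite ler_expR lerN2 -[g n ^+ 2]real_normK ?num_real// gn.
have := @pi_ge2 R; case: n => [|n] ?; first by rewrite expr0n mulr0.
have : 1 <= n.+1%:R :> R by rewrite ler1n.
nra.
Qed.

(** The phase [b] lets one real integral cover both components of the Fourier integral: [b = 0]
    gives the cosine, [b = - pi / 2] the sine. *)
Definition gauFT (b xi : R) := Rintegral mu setT (fun x => cos (2 * pi * xi *
  x + b) * gau x).

(** Differentiation under the integral, dominated by [2 pi |x| gau x], produces the factor
    [- 2 pi x gau x], which is the derivative of [gau]; integrating by parts moves that derivative
    onto the sine. *)
Lemma is_derive_gauFT (b xi : R) :
  is_derive xi 1 (gauFT b) (- (2 * pi * xi) * gauFT b xi).
Proof.
pose f (xi x : R) := cos (2 * pi * xi * x + b) * gau x.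
have df (x z : R) : is_derive z 1 (fun z => f z x) (- (2 * pi * x) * sin (2 *
  pi * z * x + b) * gau x).
  rewrite /f.
  under eq_fun do rewrite [2 * pi * _ * _]mulrAC.
  have D := is_derive_cos_affine (2 * pi * x) b z.
  apply: is_derive_eq.
  rewrite scaler0 add0r /GRing.scale /= [2 * pi * z * x]mulrAC; ring.
have int1 (h : R -> R) (C : R) : continuous h -> (forall x, `|h x| <= C * (1 +
  x ^+ 2)) ->
    mu.-integrable setT (EFin \o (fun x => h x * gau x)).
  by move=> ch; apply: integrable_gauM; exact: continuous_measurable_fun.
have cle1 u : `|cos u| <= 1 + 0 * u ^+ 2 :> R by rewrite mul0r addr0 ler_norml
  cos_geN1 cos_le1.
have sle1 u : `|sin u| <= 1 :> R by rewrite ler_norml sin_geN1 sin_le1.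
have if_ z : mu.-integrable setT (EFin \o f z).
  apply: (int1 _ 1); first exact: continuous_cos_affine.
  by move=> x; rewrite mul1r; apply: le_trans (cle1 _) _;
    rewrite mul0r addr0 lerDl sqr_ge0.
pose G (x : R) := 2 * pi * `|x| * gau x.
have iG : mu.-integrable setT (EFin \o G).
  apply: (int1 _ (2 * pi)).
    by move=> x; apply: cvgM; [exact: cvg_cst|exact: norm_continuous].
  by move=> x; rewrite normrM normr_id ger0_norm ?mulr_ge0 ?pi_ge0//
    ler_wpM2l ?ler1_sqr// mulr_ge0 ?pi_ge0.
have Gge0 x : 0 <= G x by rewrite !mulr_ge0 ?gau_ge0// pi_ge0.
have p1 z x : partial1of2 f z x = - (2 * pi * x) * sin (2 * pi * z * x + b) * gau x.
  by rewrite partial1of2E; have H := df x z; exact: derive_val.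
have xiI : `]xi - 1, xi + 1[%classic xi by rewrite /= in_itv/=; lra.
have bG z x : `]xi - 1, xi + 1[%classic z -> setT x -> `|partial1of2 f z x| <= G x.
  move=> _ _; rewrite p1 normrM [`|gau x|]ger0_norm ?gau_ge0// ler_wpM2r ?gau_ge0//.
  rewrite normrM normrN normrM [`|2 * pi|]ger0_norm ?mulr_ge0 ?pi_ge0//.
  by rewrite ler_piMr// !mulr_ge0// pi_ge0.
have D : derivable (gauFT b) xi 1.
  exact: (derivable_under_integral measurableT xiI (fun z _ => if_ z)
     (fun z x _ _ => @ex_derive _ _ _ _ _ _ _ (df x z)) Gge0 iG bG).
apply: DeriveDef => //.
rewrite -derive1E (differentiation_under_integral measurableT xiI (fun z _ => if_ z)
     (fun z x _ _ => @ex_derive _ _ _ _ _ _ _ (df x z)) Gge0 iG bG).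
under eq_Rintegral do rewrite p1.
(* [h'] is the derivative of [h]: its first term is the differentiated integrand, its second is
   [2 pi xi] times the original one. That its integral vanishes is the integration by parts. *)
pose h x := sin (2 * pi * xi * x + b) * gau x.
pose h' x := - (2 * pi * x) * sin (2 * pi * xi * x + b) * gau x
   + 2 * pi * xi * (cos (2 * pi * xi * x + b) * gau x).
have i1 : mu.-integrable setT (EFin \o (fun x => - (2 * pi * x) * sin (2 * pi *
  xi * x + b) * gau x)).
  apply: (int1 _ (2 * pi)).
    move=> x; apply: cvgM; last exact: continuous_sin_affine.
    by apply: cvgN; apply: cvgM; [exact: cvg_cst|exact: cvg_id].
  move=> x; rewrite normrM normrN normrM [`|2 * pi|]ger0_norm ?mulr_ge0 ?pi_ge0//.
  rewrite -mulrA ler_wpM2l ?mulr_ge0 ?pi_ge0//.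
  by apply: le_trans (ler1_sqr x); rewrite ler_piMr.
have i2 : mu.-integrable setT (EFin \o (fun x => 2 * pi * xi * (cos (2 * pi *
  xi * x + b) * gau x))).
  have -> : EFin \o (fun x => 2 * pi * xi * (cos (2 * pi * xi * x + b) * gau x)) =
     (fun x => (2 * pi * xi)%:E * (EFin \o f xi) x)%E by apply/funext.
  exact: integrableZl.
have : Rintegral mu setT h' = 0.
  apply: (@Rintegral_derive0 _ h).
  - move=> x; rewrite /h /h'.
    have Ds := is_derive_sin_affine (2 * pi * xi) b x.
    have Dg := is_derive_gau x.
    apply: is_derive_eq; rewrite /GRing.scale/=; ring.
  - move=> x; apply: cvgD; apply: cvgM.
    + apply: cvgM; last exact: continuous_sin_affine.
      by apply: cvgN; apply: cvgM; [exact: cvg_cst|exact: cvg_id].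
    + exact: continuous_gau.
    + exact: cvg_cst.
    + by apply: cvgM; [exact: continuous_cos_affine|exact: continuous_gau].
  - exact: (integrableD measurableT i1 i2).
  - by apply: bounded_mul_gau_cvg0 => // n; rewrite ger0_norm.
  - by apply: bounded_mul_gau_cvg0 => // n; rewrite normrN ger0_norm.
rewrite RintegralD// RintegralZl//; last exact: if_.
move=> /eqP; rewrite addr_eq0 => /eqP ->.
by rewrite mulNr.
Qed.

(** Solves the differential equation just obtained: [gauFT b z * e^(pi z^2)] has zero derivative,
    and its value at 0 is [cos b]. *)
Lemma gauFTE (b xi : R) : gauFT b xi = cos b * gau xi.
Proof.
pose F (z : R) := gauFT b z * expR (pi * z ^+ 2).
have dF (z : R) : is_derive z 1 F 0.
  have D := is_derive_gauFT b z.
  rewrite /F; apply: is_derive_eq; rewrite /GRing.scale/=; ring.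
have : F xi = F 0 by exact: is_derive_0_is_cst.
rewrite /F expr0n mulr0 expR0 mulr1 {2}/gauFT.
under eq_Rintegral do rewrite mulr0 mul0r add0r.
rewrite RintegralZl//; last exact: integrable_gau.
rewrite Rintegral_gau mulr1 => <-.
by rewrite -mulrA /gau -expRD addrN expR0 mulr1.
Qed.

(** The image measure agrees with Lebesgue measure on half-open intervals, which determine it. *)
Lemma lebesgue_measure_translate (a : R) (A : set R) : measurable A ->
  pushforward mu (fun x : measurableTypeR R => x + a : measurableTypeR R) A = mu A.
Proof.
have ma : measurable_fun setT (fun x : measurableTypeR R => x +
  a : measurableTypeR R).
  exact: measurable_funD.
move=> mA; apply/esym/lebesgue_measure_unique => //= _ [[c d]] _ <-.
rewrite /pushforward /= (_ : _ @^-1` _ = `]c - a, d - a]%classic); last first.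
  by apply/seteqP; split => x /=; rewrite !in_itv/= ltrBlDr lerBrDr.
rewrite !lebesgue_measure_itv/= !lte_fin ltrBlDr subrK.
by case: ifP => // _; rewrite -EFinB; congr (_%:E); ring.
Qed.

Lemma Rintegral_translate (a : R) (f : R -> R) : measurable_fun setT f ->
  mu.-integrable setT (EFin \o (fun x => f (x + a))) ->
  Rintegral mu setT f = Rintegral mu setT (fun x => f (x + a)).
Proof.
move=> mf i; rewrite /Rintegral; congr fine.
have ma : measurable_fun setT (fun x : measurableTypeR R => x +
  a : measurableTypeR R).
  exact: measurable_funD.
have := @integral_pushforward _ _ _ _ _ _ ma mu setT (EFin \o f) _ _ measurableT.
rewrite preimage_setT => <- //; last exact/measurable_EFinP.
by apply: eq_measure_integral => //= A mA _; exact/esym/lebesgue_measure_translate.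
Qed.

End gaussian_fourier.

(** * Integrals of tensor products over R^n *)

Section product_integral.
Context {R : realType}.
Local Notation mu := (@lebesgue_measure R).

Lemma integrable_prod_meas d1 d2 (T1 : measurableType d1) (T2 : measurableType d2)
    (m1 : {sigma_finite_measure set T1 -> \bar R})
    (m2 : {sigma_finite_measure set T2 -> \bar R}) (a : T1 -> R) (b : T2 -> R) :
  m1.-integrable setT (EFin \o a) -> m2.-integrable setT (EFin \o b) ->
  (m1 \x m2)%E.-integrable setT (EFin \o (fun p => a p.1 * b p.2)).
Proof.
move=> ia ib.
have ma : measurable_fun setT a by apply/measurable_EFinP; case/integrableP: ia.
have mb : measurable_fun setT b by apply/measurable_EFinP; case/integrableP: ib.
have mab : measurable_fun setT (fun p : T1 * T2 => a p.1 * b p.2).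
  by apply: measurable_funM; apply: measurableT_comp => //.
apply/integrableP; split; first exact/measurable_EFinP.
rewrite fubini_tonelli1//; last 1 first.
- by apply: measurableT_comp => //; exact/measurable_EFinP.
have -> : fubini_F m2 (fun p : T1 * T2 => `|(a p.1 * b p.2)%:E|%E) =
   (fun x => `|a x|%:E * \int[m2]_y `|(b y)%:E|)%E.
  apply/funext => x; rewrite /fubini_F -ge0_integralZl//.
    by apply: eq_integral => y _ /=; rewrite normrM EFinM.
  by apply: measurableT_comp => //; exact/measurable_EFinP.
case/integrableP: ia => _ /= ia; case/integrableP: ib => mb' ib.
rewrite ge0_integralZr//; last 2 first.
- by apply/measurable_EFinP; exact: measurableT_comp.
- exact: integral_ge0.
apply: lte_mul_pinfty => //; first exact: integral_ge0.
by rewrite ge0_fin_numE//; exact: integral_ge0.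
Qed.

Lemma Rintegral_prod_meas d1 d2 (T1 : measurableType d1) (T2 : measurableType d2)
    (m1 : {sigma_finite_measure set T1 -> \bar R})
    (m2 : {sigma_finite_measure set T2 -> \bar R}) (a : T1 -> R) (b : T2 -> R) :
  m1.-integrable setT (EFin \o a) -> m2.-integrable setT (EFin \o b) ->
  (\int[(m1 \x m2)%E]_p (a p.1 * b p.2)) = (\int[m1]_x a x) * (\int[m2]_y b y).
Proof.
move=> ia ib; rewrite {1}/Rintegral -(integral12_prod_meas1 (integrable_prod_meas
  ia ib)).
rewrite mulrC -RintegralZl// /Rintegral; congr fine.
apply: eq_integral => x _; rewrite /fubini_F /=.
under eq_integral do rewrite EFinM.
rewrite integralZl// mulrC EFinM; congr (_ * _)%E.
by rewrite fineK//; exact: integrable_fin_num.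
Qed.

(** [lebesgue_rV R n.+1] is the image of a product measure under [rV_cons], so a change of variables
    reduces the claim to Fubini. It is the induction step on the dimension. *)
Lemma integral_rV_cons n (a : R -> R) (b : 'rV[R]_n -> R) (g : 'rV[R]_n.+1 -> R) :
  mu.-integrable setT (EFin \o a) -> (lebesgue_rV R n).-integrable setT (EFin \o
    b) ->
  (forall p, g (rV_cons p) = a p.1 * b p.2) ->
  (lebesgue_rV R n.+1).-integrable setT (EFin \o g) /\
  \int[lebesgue_rV R n.+1]_x g x = (\int[mu]_x a x) * (\int[lebesgue_rV R n]_x b x).
Proof.
move=> ia ib gE.
have ma : measurable_fun setT a by apply/measurable_EFinP; case/integrableP: ia.
have mb : measurable_fun setT b by apply/measurable_EFinP; case/integrableP: ib.
have mg : measurable_fun setT (EFin \o g).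
  apply/measurable_EFinP.
  have -> : g = (fun p => a p.1 * b p.2) \o @rV_uncons R n.
    by apply/funext => x /=; rewrite -{1}[x]rV_unconsK gE.
  apply: measurableT_comp; last exact: measurable_rV_uncons.
  by apply: measurable_funM; apply: measurableT_comp => //.
have iab := integrable_prod_meas ia ib.
have gc : (EFin \o g) \o @rV_cons R n = EFin \o (fun p => a p.1 * b p.2).
  by apply/funext => p /=; rewrite gE.
split.
  have := @integrable_pushforward _ _ (measurableTypeR R *
    'rV[R]_n)%type 'rV[R]_n.+1 R (@rV_cons R n) (@measurable_rV_cons R n) (mu \x
      lebesgue_rV R n)%E setT _ mg.
  rewrite preimage_setT gc => /(_ iab measurableT).
  exact.
rewrite -Rintegral_prod_meas// /Rintegral; congr fine.
have := @integral_pushforward _ _ (measurableTypeR R *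
  'rV[R]_n)%type 'rV[R]_n.+1 R (@rV_cons R n) (@measurable_rV_cons R n) (mu \x
    lebesgue_rV R n)%E setT _ mg.
rewrite preimage_setT gc => /(_ iab measurableT) => H.
exact: H.
Qed.

Lemma integral_rV0 (f : 'rV[R]_0 -> \bar R) : measurable_fun setT f ->
  (\int[lebesgue_rV R 0]_x f x = f 0%R)%E.
Proof.
move=> mf; have := @integral_dirac _ _ (0 : 'rV[R]_0) R setT measurableT f mf.
by rewrite diracT mul1e.
Qed.

Lemma Rintegral_prod_rV n (F : 'I_n -> R -> R) :
  (forall i, mu.-integrable setT (EFin \o F i)) ->
  (lebesgue_rV R n).-integrable setT
    (EFin \o (fun x : 'rV[R]_n => \prod_i F i (x ord0 i))) /\
  \int[lebesgue_rV R n]_x (\prod_i F i (x ord0 i)) = \prod_i \int[mu]_x F i x.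
Proof.
elim: n F => [|n IH] F iF.
  have -> : (fun x : 'rV[R]_0 => \prod_i F i (x ord0 i)) = cst 1.
    by apply/funext => x; rewrite big_ord0.
  rewrite big_ord0; split.
    apply/integrableP; split; first exact/measurable_EFinP.
    by rewrite integral_rV0 //= normr1 ltry.
  by rewrite /Rintegral integral_rV0 //; exact/measurable_EFinP.
have [i1 E1] := IH (fun i => F (lift ord0 i)) (fun i => iF _).
have [||i2 E2] := @integral_rV_cons n (F ord0) _
   (fun x : 'rV[R]_n.+1 => \prod_i F i (x ord0 i)) _ i1 => //.
  move=> p; rewrite big_ord_recl rV_cons0; congr (_ * _).
  by apply: eq_bigr => i _; rewrite rV_consS.
by split => //; rewrite E2 E1 big_ord_recl.
Qed.

Definition cintegrable1 (f : R -> R[i]) :=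
  mu.-integrable setT (EFin \o (fun x => complex.Re (f x))) /\
  mu.-integrable setT (EFin \o (fun x => complex.Im (f x))).

Definition cint1 (f : R -> R[i]) : R[i] :=
  (\int[mu]_x complex.Re (f x)) +i* (\int[mu]_x complex.Im (f x)).

(** The shape of the real part ([c = -1]) and of the imaginary part ([c = 1]) of a product of two
    complex factors. *)
Lemma integral_rV_consB n (a1 a2 : R -> R) (b1 b2 : 'rV[R]_n ->
  R) (g : 'rV[R]_n.+1 -> R) (c : R) :
  mu.-integrable setT (EFin \o a1) -> (lebesgue_rV R n).-integrable setT (EFin \o
    b1) ->
  mu.-integrable setT (EFin \o a2) -> (lebesgue_rV R n).-integrable setT (EFin \o
    b2) ->
  (forall p, g (rV_cons p) = a1 p.1 * b1 p.2 + c * (a2 p.1 * b2 p.2)) ->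
  (lebesgue_rV R n.+1).-integrable setT (EFin \o g) /\
  \int[lebesgue_rV R n.+1]_x g x =
    (\int[mu]_x a1 x) * (\int[lebesgue_rV R n]_x b1 x) +
    c * ((\int[mu]_x a2 x) * (\int[lebesgue_rV R n]_x b2 x)).
Proof.
move=> ia1 ib1 ia2 ib2 gE.
pose g1 (x : 'rV[R]_n.+1) := a1 (rV_uncons x).1 * b1 (rV_uncons x).2.
pose g2 (x : 'rV[R]_n.+1) := a2 (rV_uncons x).1 * b2 (rV_uncons x).2.
have [|i1 <-] := @integral_rV_cons n a1 b1 g1 ia1 ib1.
  by move=> p; rewrite /g1 rV_consK.
have [|i2 <-] := @integral_rV_cons n a2 b2 g2 ia2 ib2.
  by move=> p; rewrite /g2 rV_consK.
have -> : g = fun x => g1 x + c * g2 x.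
  by apply/funext => x; rewrite -{1}[x]rV_unconsK gE.
have i3 : (lebesgue_rV R n.+1).-integrable setT (EFin \o (fun x => c * g2 x)).
  by have := integrableZl measurableT c i2.
split; first by have := integrableD measurableT i1 i3.
by rewrite RintegralD// RintegralZl.
Qed.

Lemma cintegral_prod_rV n (F : 'I_n -> R -> R[i]) :
  (forall i, cintegrable1 (F i)) ->
  cintegral (fun x : 'rV[R]_n => \prod_i F i (x ord0 i)) = \prod_i cint1 (F i).
Proof.
(* The induction also has to carry the integrability of both components of the product. *)
move=> iF; suff [_ _ ->] : [/\
  (lebesgue_rV R n).-integrable setT
    (EFin \o (fun x : 'rV[R]_n => complex.Re (\prod_i F i (x ord0 i)))),
  (lebesgue_rV R n).-integrable setT
    (EFin \o (fun x : 'rV[R]_n => complex.Im (\prod_i F i (x ord0 i)))) &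
  cintegral (fun x : 'rV[R]_n => \prod_i F i (x ord0 i)) =
    \prod_i cint1 (F i)] by [].
elim: n F iF => [|n IH] F iF.
  have E : (fun x : 'rV[R]_0 => \prod_i F i (x ord0 i)) = cst 1.
    by apply/funext => x; rewrite big_ord0.
  have -> : (fun x : 'rV[R]_0 => complex.Re (\prod_i F i (x ord0 i))) = cst 1.
    by apply/funext => x; rewrite big_ord0.
  have -> : (fun x : 'rV[R]_0 => complex.Im (\prod_i F i (x ord0 i))) = cst 0.
    by apply/funext => x; rewrite big_ord0.
  rewrite E big_ord0 /cintegral; split.
  - apply/integrableP; split; first exact/measurable_EFinP.
    by rewrite integral_rV0 //= normr1 ltry.
  - exact: integrable0.
  - by rewrite /Rintegral !integral_rV0 //; exact/measurable_EFinP.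
have [i1 i2 E1] := IH (fun i => F (lift ord0 i)) (fun i => iF _).
have [i3 i4] := iF ord0.
pose G (x : 'rV[R]_n) := \prod_i F (lift ord0 i) (x ord0 i).
have E p : \prod_i F i ((@rV_cons R n p) ord0 i) = F ord0 p.1 * G p.2.
  rewrite big_ord_recl rV_cons0; congr (_ * _).
  by apply: eq_bigr => i _; rewrite rV_consS.
have [|j1 J1] := @integral_rV_consB n (fun x => complex.Re (F ord0 x)) (fun x =>
  complex.Im (F ord0 x))
  (fun x => complex.Re (G x)) (fun x => complex.Im (G x))
   (fun x : 'rV[R]_n.+1 => complex.Re (\prod_i F i (x ord0 i))) (-1) i3 i1 i4 i2.
  move=> p; rewrite E mulN1r.
  by case: (F ord0 p.1) => ? ?; case: (G p.2).
have [|j2 J2] := @integral_rV_consB n (fun x => complex.Re (F ord0 x)) (fun x =>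
  complex.Im (F ord0 x))
  (fun x => complex.Im (G x)) (fun x => complex.Re (G x))
   (fun x : 'rV[R]_n.+1 => complex.Im (\prod_i F i (x ord0 i))) 1 i3 i2 i4 i1.
  move=> p; rewrite E mul1r.
  by case: (F ord0 p.1) => ? ?; case: (G p.2).
split => //.
rewrite big_ord_recl -E1 /cintegral J1 J2 /cint1 mulN1r mul1r.
by [].
Qed.

End product_integral.

(** * Tensor products of Schwartz functions of one variable *)

Section schwartz_products.
Context {R : realType}.

Lemma Re_mulc (a b : R[i]) : complex.Re (a * b) =
  complex.Re a * complex.Re b - complex.Im a * complex.Im b.
Proof. by case: a; case: b. Qed.

Lemma Im_mulc (a b : R[i]) : complex.Im (a * b) =
  complex.Re a * complex.Im b + complex.Im a * complex.Re b.
Proof. by case: a; case: b. Qed.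

Lemma Re_addc (a b : R[i]) : complex.Re (a + b) = complex.Re a + complex.Re b.
Proof. by case: a; case: b. Qed.

Lemma Im_addc (a b : R[i]) : complex.Im (a + b) = complex.Im a + complex.Im b.
Proof. by case: a; case: b. Qed.

Lemma normcD (a b : R[i]) : Normc.normc (a + b) <= Normc.normc a + Normc.normc b.
Proof. by have := ler_normD a b; rewrite -lecR rmorphD. Qed.

Lemma normc_prod n (F : 'I_n -> R[i]) :
  Normc.normc (\prod_i F i) = \prod_i Normc.normc (F i).
Proof.
elim/big_ind2: _ => //; first by rewrite /= expr1n expr0n addr0 sqrtr1.
by move=> x a y b <- <-; rewrite Normc.normcM.
Qed.

(** A directional derivative only sees the restriction to a line, so partial derivatives of a tensor
    product become derivatives in one variable. *)
Lemma is_derive_line n (f : 'rV[R]_n -> R) (phi : R ->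
  R) (x v : 'rV[R]_n) (y d : R) :
  (forall h, f (h *: v + x) = phi (h + y)) -> is_derive y (1 : R) phi d ->
  is_derive x v f d.
Proof.
move=> E D.
have E' : (fun h => h^-1 *: ((f \o shift x) (h *: v) - f x)) =
   (fun h => h^-1 *: ((phi \o shift y) (h *: (1 : R)) - phi y)).
  apply/funext => h /=; rewrite E (_ : h *: (1 : R) = h); last exact: mulr1.
  by have := E 0; rewrite scale0r !add0r => ->.
case: D => d1 d2; split; first by rewrite /derivable E'.
by rewrite /derive E'.
Qed.

(** Here [g k] is the [k]-th derivative of [g 0]; carrying the derivatives as data gives iterated
    partial derivatives of products a closed form. *)
Definition schwartz_jet (g : nat -> R -> R[i]) : Prop :=
  (forall k x, is_derive x (1 : R) (fun x => complex.Re (g k x)) (complex.Re (g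
    k.+1 x)) /\
    is_derive x (1 : R) (fun x => complex.Im (g k x)) (complex.Im (g k.+1 x))) /\
  (forall a k, exists M : R, forall x, `|x| ^+ a * Normc.normc (g k x) <= M).

(** [c] is the multi-index of the derivatives already taken. Only the [i]-th factor varies along the
    [i]-th axis; the others form the constant [K]. *)
Lemma derive_prod n (G : 'I_n -> nat -> R -> R[i]) (c : 'I_n ->
  nat) (i : 'I_n) (x : 'rV[R]_n) :
  (forall j, schwartz_jet (G j)) ->
  is_derive x (delta_mx ord0 i) (fun x : 'rV[R]_n => complex.Re (\prod_j G j (c
    j) (x ord0 j)))
    (complex.Re (\prod_j G j (c j + (i == j))%N (x ord0 j))) /\
  is_derive x (delta_mx ord0 i) (fun x : 'rV[R]_n => complex.Im (\prod_j G j (c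
    j) (x ord0 j)))
    (complex.Im (\prod_j G j (c j + (i == j))%N (x ord0 j))).
Proof.
move=> sG; pose K := \prod_(j | j != i) G j (c j) (x ord0 j).
have E h : \prod_j G j (c j) ((h *: delta_mx ord0 i + x) ord0 j) =
  G i (c i) (h + x ord0 i) * K.
  rewrite (bigD1 i)//= !mxE !eqxx mulr1; congr (_ * _).
  by apply: eq_bigr => j ji; rewrite !mxE (negbTE ji) andbF mulr0 add0r.
have -> : \prod_j G j (c j + (i == j))%N (x ord0 j) = G i (c i).+1 (x ord0 i) * K.
  rewrite (bigD1 i)//= eqxx addn1; congr (_ * _).
  by apply: eq_bigr => j; rewrite eq_sym => /negbTE ->; rewrite addn0.
have [dG _] := sG i; have [d1 d2] := dG (c i) (x ord0 i).
split.
  apply: (@is_derive_line _ _ (fun y => complex.Re (G i (c i) y *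
    K)) _ _ (x ord0 i)).
    by move=> h; rewrite E.
  under eq_fun do rewrite Re_mulc.
  by apply: is_derive_eq; rewrite Re_mulc /GRing.scale /=; ring.
apply: (@is_derive_line _ _ (fun y => complex.Im (G i (c i) y * K)) _ _ (x ord0 i)).
  by move=> h; rewrite E.
under eq_fun do rewrite Im_mulc.
by apply: is_derive_eq; rewrite Im_mulc /GRing.scale /=; ring.
Qed.

Lemma cpartials_prod n (G : 'I_n -> nat -> R -> R[i]) (b : seq 'I_n) :
  (forall j, schwartz_jet (G j)) ->
  cpartials b (fun x : 'rV[R]_n => \prod_j G j 0 (x ord0 j)) =
  (fun x => \prod_j G j (count_mem j b) (x ord0 j)).
Proof.
move=> sG; elim: b => [|i b IH]; first by apply/funext.
rewrite [LHS]/= -/(cpartials b _) IH; apply/funext => x; rewrite /cpartial.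
have [d1 d2] := derive_prod (fun j => count_mem j b) i x sG.
rewrite (@derive_val _ _ _ _ _ _ _ d1) (@derive_val _ _ _ _ _ _ _ d2).
have -> : \prod_j G j (count_mem j (i :: b)) (x ord0 j) =
    \prod_j G j (count_mem j b + (i == j))%N (x ord0 j).
  by apply: eq_bigr => j _ /=; rewrite addnC.
by case: (\prod_j _).
Qed.

Lemma continuous_prod n (F : 'I_n -> R -> R[i]) :
  (forall i, continuous (fun x => complex.Re (F i x))) ->
  (forall i, continuous (fun x => complex.Im (F i x))) ->
  ccontinuous (fun x : 'rV[R]_n => \prod_i F i (x ord0 i)).
Proof.
move=> cR cI; rewrite /ccontinuous.
have cc (g : R -> R) i : continuous g -> continuous (fun x : 'rV[R]_n => g (x
  ord0 i)).
  move=> cg x; apply: (@continuous_comp _ _ _ (fun x : 'rV[R]_n => x ord0 i)).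
    exact: coord_continuous.
  exact: cg.
elim: (index_enum _) => [|i r [IH1 IH2]].
  split; (under eq_fun do rewrite big_nil /=); exact: cst_continuous.
have cRi := cc (fun y => complex.Re (F i y)) i (cR i).
have cIi := cc (fun y => complex.Im (F i y)) i (cI i).
split.
  under eq_fun do rewrite big_cons Re_mulc.
  by move=> x; exact: (cvgB (cvgM (cRi x) (IH1 x)) (cvgM (cIi x) (IH2 x))).
under eq_fun do rewrite big_cons Im_mulc.
by move=> x; exact: (cvgD (cvgM (cRi x) (IH2 x)) (cvgM (cIi x) (IH1 x))).
Qed.

Lemma is_derive1_continuous (f f' : R -> R) : (forall x, is_derive x (1 : R) f
  (f' x)) -> continuous f.
Proof.
by move=> D x; apply: differentiable_continuous; apply/derivable1_diffP;
  have [] := D x.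
Qed.

Lemma normc_ge0 (z : R[i]) : 0 <= Normc.normc z.
Proof. by case: z => a b; exact: sqrtr_ge0. Qed.

(** Monomials and iterated partial derivatives both factor over the coordinates, so the
    one-dimensional bounds multiply. *)
Lemma schwartz_prod n (G : 'I_n -> nat -> R -> R[i]) :
  (forall j, schwartz_jet (G j)) ->
  schwartz (fun x : 'rV[R]_n => \prod_j G j 0 (x ord0 j)).
Proof.
move=> sG; split=> [b|a b]; rewrite cpartials_prod//.
  split.
    apply: (@continuous_prod _ (fun i => G i (count_mem i b))) => i.
      by apply: is_derive1_continuous => x; have [/(_ (count_mem i b) x)[+ _] _]
        := sG i; exact.
    by apply: is_derive1_continuous => x; have [/(_ (count_mem i b) x)[_ +] _] :=
      sG i; exact.
  move=> i x; have [d1 d2] := derive_prod (fun j => count_mem j b) i x sG.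
  by split; [case: d1|case: d2].
have /choice[M HM] : forall i : 'I_n, exists M : R, forall y : R,
    `|y| ^+ a i * Normc.normc (G i (count_mem i b) y) <= M.
  by move=> i; have [_] := sG i; exact.
exists (\prod_i M i) => x.
rewrite normr_prod normc_prod -big_split /=.
apply: ler_prod => i _; rewrite mulr_ge0 ?normc_ge0//= normrX.
exact: HM.
Qed.

Lemma schwartz_jet_sum (I : Type) (r : seq I) (g : I -> nat -> R -> R[i]) :
  (forall i, schwartz_jet (g i)) -> schwartz_jet (fun k x => \sum_(i <- r) g i k x).
Proof.
move=> sg; elim: r => [|i r [IHd IHb]].
  split=> [k x|a k].
    split; (under eq_fun do rewrite big_nil /=); rewrite big_nil;
      exact: is_derive_cst.
  by exists 0 => x; rewrite big_nil /= expr0n addr0 sqrtr0 mulr0.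
have [sd sb] := sg i.
split=> [k x|a k].
  have [d1 d2] := sd k x; have [e1 e2] := IHd k x.
  split.
    under eq_fun do rewrite big_cons Re_addc.
    by rewrite big_cons Re_addc; exact: is_deriveD.
  under eq_fun do rewrite big_cons Im_addc.
  by rewrite big_cons Im_addc; exact: is_deriveD.
have [M HM] := sb a k; have [N HN] := IHb a k.
exists (M + N) => x; rewrite big_cons.
apply: le_trans (lerD (HM x) (HN x)).
rewrite -mulrDr ler_wpM2l ?exprn_ge0//.
exact: normcD.
Qed.

End schwartz_products.

(** * Modulated Gaussians are Schwartz functions *)

Section modulated_gaussian.
Context {R : realType}.

Lemma poly_gau_bounded (p : {poly R}) : exists M, forall x, `|p.[x]| * gau x <= M.
Proof.
have Xn n : exists M, forall x : R, `|x| ^+ n * gau x <= M.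
  exists (1 + (n.+1)`!%:R) => x.
  have g1 : gau x <= 1 by rewrite -expR0 ler_expR oppr_le0 mulr_ge0 ?pi_ge0
    ?sqr_ge0.
  (* An even power is a power of [x^2], hence is controlled by one term of the series of [e^(x^2)];
     the factor [e^(-pi x^2)] then absorbs that exponential. *)
  have h : `|x| ^+ n <= 1 + (x ^+ 2) ^+ n.+1.
    have [x1|x1] := leP `|x| 1.
      by rewrite (le_trans (exprn_ile1 _ (normr_ge0 x) x1))//
        lerDl exprn_ge0 ?sqr_ge0.
    rewrite -[x ^+ 2]real_normK ?num_real// -exprM.
    apply: (@le_trans _ _ (`|x| ^+ (2 * n.+1))); last by rewrite lerDr.
    by rewrite ler_weXn2l ?ltW// (leq_trans (leqnSn n))// leq_pmull.
  apply: le_trans (ler_wpM2r (gau_ge0 x) h) _.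
  rewrite mulrDl mul1r lerD//.
  have := expR_ge1Dxn n (sqr_ge0 x) => e1.
  have e2 : (x ^+ 2) ^+ n.+1 <= (n.+1)`!%:R * expR (x ^+ 2).
    rewrite mulrC -ler_pdivrMr ?ltr0n ?fact_gt0//.
    by apply: le_trans e1; rewrite lerDr.
  apply: le_trans (ler_wpM2r (gau_ge0 x) e2) _.
  rewrite -mulrA ler_piMr// -expRD -expR0 ler_expR.
  have := @pi_ge2 R; have := sqr_ge0 x; nra.
have [M HM] := choice Xn.
exists (\sum_(i < size p) `|p`_i| * M i) => x.
rewrite horner_coef.
apply: le_trans (ler_wpM2r (gau_ge0 x) (ler_norm_sum _ _ _)) _.
rewrite mulr_suml; apply: ler_sum => i _.
by rewrite normrM normrX -mulrA ler_wpM2l.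
Qed.

(** Differentiating [(p + i q) e^(iax) e^(-pi x^2)] replaces [p + i q] by [(p + i q)' - 2 pi x (p +
    i q) + i a (p + i q)]; these are its real and imaginary parts. *)
Definition jet_step (a : R) (pq : {poly R} * {poly R}) : {poly R} * {poly R} :=
  (pq.1^`() - (2 * pi) *: ('X * pq.1) - a *: pq.2,
   pq.2^`() - (2 * pi) *: ('X * pq.2) + a *: pq.1).

(* [(p + i q)(x) e^{iax} e^{- pi x^2}], for real polynomials [p] and [q] *)
Definition poly_wave (a : R) (pq : {poly R} * {poly R}) (x : R) : R[i] :=
  (gau x * (pq.1.[x] * cos (a * x) - pq.2.[x] * sin (a * x))) +i*
  (gau x * (pq.1.[x] * sin (a * x) + pq.2.[x] * cos (a * x))).

Definition wave_jet (a : R) (k : nat) : R -> R[i] :=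
  poly_wave a (iter k (jet_step a) (1, 0)).

Lemma wave_jet0 (a x : R) : wave_jet a 0 x = (gau x * cos (a * x)) +i* (gau x *
  sin (a * x)).
Proof. by rewrite /wave_jet/poly_wave/= !hornerE !(mul0r, mul1r, subr0, addr0). Qed.

Lemma schwartz_wave_jet (a : R) : schwartz_jet (wave_jet a).
Proof.
split=> [k x|n k].
  rewrite /wave_jet iterS; case: (iter _ _ _) => p q.
  have dg := is_derive_gau x.
  have dc : is_derive x 1 (fun x : R => cos (a * x)) (- a * sin (a * x)).
    by have := is_derive_cos_affine a 0 x; under eq_fun do rewrite addr0;
      rewrite addr0.
  have ds : is_derive x 1 (fun x : R => sin (a * x)) (a * cos (a * x)).
    by have := is_derive_sin_affine a 0 x; under eq_fun do rewrite addr0;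
      rewrite addr0.
  have dp := is_derive_poly p x; have dq := is_derive_poly q x.
  rewrite /poly_wave /=.
  by split; apply: is_derive_eq; rewrite /GRing.scale /= !hornerE /=; ring.
rewrite /wave_jet; case: (iter _ _ _) => p q.
have [M HM] := poly_gau_bounded ('X ^+ n * p).
have [N HN] := poly_gau_bounded ('X ^+ n * q).
exists (M + N) => x; apply: le_trans (lerD (HM x) (HN x)).
rewrite !hornerM !hornerXn !normrM !normrX -!mulrA -mulrDr ler_wpM2l ?exprn_ge0//.
rewrite -mulrDl [leRHS]mulrC.
have -> : Normc.normc (poly_wave a (p, q) x) = gau x * Num.sqrt (p.[x] ^+ 2 +
  q.[x] ^+ 2).
  rewrite /= -[gau x in RHS](ger0_norm (gau_ge0 x)) -sqrtr_sqr -sqrtrM ?sqr_ge0//.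
  congr Num.sqrt.
  have := cos2Dsin2 (a * x); set c := cos _; set s := sin _ => cs.
  rewrite -[X in _ = _ * X]mulr1 -cs; ring.
rewrite ler_wpM2l ?gau_ge0//.
rewrite -[leRHS]ger0_norm ?addr_ge0// -sqrtr_sqr ler_sqrt ?sqr_ge0//.
by rewrite sqrrD !real_normK ?num_real// -addrA lerD2l lerDr mulrn_wge0// mulr_ge0.
Qed.

End modulated_gaussian.

(** * One-dimensional packets: Fourier transform and lower bound for the evolution *)

Section packets.
Context {R : realType}.
Local Notation mu := (@lebesgue_measure R).

Lemma cexpiD (a b : R) : cexpi (a + b) = cexpi a * cexpi b.
Proof.
by apply/eqP; rewrite eq_complex /= cosD sinD [X in _ && (X == _)]addrC !eqxx.
Qed.

Lemma normc_cexpi (a : R) : Normc.normc (cexpi a) = 1.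
Proof. by rewrite /= cos2Dsin2 sqrtr1. Qed.

Lemma cintegrable1D (f g : R -> R[i]) : cintegrable1 f -> cintegrable1 g ->
  cintegrable1 (fun x => f x + g x).
Proof.
move=> [f1 f2] [g1 g2]; split.
  rewrite (_ : (fun x => complex.Re (f x + g x)) =
    (fun x => complex.Re (f x) + complex.Re (g x))).
    exact: (integrableD measurableT f1 g1).
  by apply/funext => x; rewrite Re_addc.
rewrite (_ : (fun x => complex.Im (f x + g x)) =
  (fun x => complex.Im (f x) + complex.Im (g x))).
  exact: (integrableD measurableT f2 g2).
by apply/funext => x; rewrite Im_addc.
Qed.

Lemma cint1D (f g : R -> R[i]) : cintegrable1 f -> cintegrable1 g ->
  cint1 (fun x => f x + g x) = cint1 f + cint1 g.
Proof.
move=> [f1 f2] [g1 g2]; rewrite /cint1.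
under eq_Rintegral do rewrite Re_addc; under [X in _ +i* X]eq_Rintegral do
  rewrite Im_addc.
by rewrite !RintegralD//; simpc.
Qed.

Lemma cint1_sum (I : Type) (r : seq I) (f : I -> R -> R[i]) :
  (forall i, cintegrable1 (f i)) ->
  cintegrable1 (fun x => \sum_(i <- r) f i x) /\
  cint1 (fun x => \sum_(i <- r) f i x) = \sum_(i <- r) cint1 (f i).
Proof.
move=> fi; elim: r => [|i r [IHi IHe]].
  rewrite /cintegrable1 /cint1 big_nil.
  rewrite (_ : (fun x => complex.Re _) = cst 0); last by apply/funext => x;
    rewrite big_nil.
  rewrite (_ : (fun x => complex.Im _) = cst 0); last by apply/funext => x;
    rewrite big_nil.
  split; first by split; exact: integrable0.
  by rewrite /Rintegral integral0.
rewrite big_cons -IHe -cint1D//.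
rewrite (_ : (fun x => \sum_(i <- i :: r) f i x) =
  (fun x => f i x + \sum_(i <- r) f i x)).
  by split => //; exact: cintegrable1D.
by apply/funext => x; rewrite big_cons.
Qed.

Lemma gauN (x : R) : gau (- x) = gau x.
Proof. by rewrite /gau sqrrN. Qed.

Lemma measurable_cos_quad (a b c : R) : measurable_fun setT (fun x : R => cos (a
  * x ^+ 2 + b * x + c)).
Proof.
apply: measurableT_comp; first by apply: continuous_measurable_fun;
  exact: continuous_cos.
by apply: measurable_funD => //; apply: measurable_funD; apply: measurable_funM.
Qed.

Lemma normr_cos_le1 (u : R) : `|cos u| <= 1.
Proof. by rewrite ler_norml cos_geN1 cos_le1. Qed.

Lemma pi_le4 : pi <= 4 :> R.
Proof. by have := @pihalf_lt2 R; lra. Qed.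

Lemma integrable_cos_gau (a b c : R) :
  mu.-integrable setT (EFin \o (fun x => cos (a * x ^+ 2 + b * x + c) * gau x)).
Proof.
apply: (integrable_gauM (C := 1)); first exact: measurable_cos_quad.
by move=> x; rewrite mul1r (le_trans (normr_cos_le1 _))// lerDl sqr_ge0.
Qed.

Lemma sin_cosBpihalf (u : R) : sin u = cos (u - pi / 2).
Proof. by rewrite cosB cos_pihalf sin_pihalf mulr0 add0r mulr1. Qed.

(** The two components are [gauFT] at [a - eta] with phases 0 and [- pi / 2]; the second vanishes
    with [cos (pi / 2)]. *)
Lemma fourier_wave (a eta : R) :
  cintegrable1 (fun x => wave_jet (2 * pi * a) 0 x * cexpi (- (2 * pi * (x *
    eta)))) /\
  cint1 (fun x => wave_jet (2 * pi * a) 0 x * cexpi (- (2 * pi * (x * eta)))) =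
    (gau (eta - a))%:C.
Proof.
have E x : wave_jet (2 * pi * a) 0 x * cexpi (- (2 * pi * (x * eta))) =
   (cos (2 * pi * (a - eta) * x + 0) * gau x) +i* (cos (2 * pi * (a - eta) *
     x + - (pi / 2)) * gau x).
  rewrite wave_jet0 addr0 -sin_cosBpihalf.
  have -> : 2 * pi * (a - eta) * x = 2 * pi * a * x +
    - (2 * pi * (x * eta)) by ring.
  rewrite cosD sinD /cexpi; simpc; congr (_ +i* _); ring.
have i b : mu.-integrable setT (EFin \o (fun x => cos (2 * pi * (a - eta) * x +
  b) * gau x)).
  have := integrable_cos_gau 0 (2 * pi * (a - eta)) b.
  by under eq_fun do rewrite mul0r add0r.
have -> : (fun x => wave_jet (2 * pi * a) 0 x * cexpi (- (2 * pi * (x * eta)))) =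
    (fun x => (cos (2 * pi * (a - eta) * x + 0) * gau x) +i*
       (cos (2 * pi * (a - eta) * x + - (pi / 2)) * gau x)) by apply/funext.
split; first by split; exact: i.
rewrite /cint1 -![Rintegral _ _ _]/(gauFT _ _) !gauFTE cosN cos_pihalf cos0 mul1r
  mul0r.
by rewrite -opprB gauN.
Qed.

Definition packet m (xi : 'I_m -> R) (x : R) : R[i] :=
  \sum_l wave_jet (2 * pi * xi l) 0 x.

Lemma fourier_packet m (xi : 'I_m -> R) (eta : R) :
  cintegrable1 (fun x => packet xi x * cexpi (- (2 * pi * (x * eta)))) /\
  cint1 (fun x => packet xi x * cexpi (- (2 * pi * (x * eta)))) =
    (\sum_l gau (eta - xi l))%:C.
Proof.
have -> : (fun x => packet xi x * cexpi (- (2 * pi * (x * eta)))) =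
  (fun x => \sum_l wave_jet (2 * pi * xi l) 0 x * cexpi (- (2 * pi * (x * eta)))).
  by apply/funext => x; rewrite /packet mulr_suml.
have [|H1 ->] := @cint1_sum _ (index_enum 'I_m) (fun l x => wave_jet (2 * pi *
  xi l) 0 x * cexpi (- (2 * pi * (x * eta)))).
  by move=> l; have [] := fourier_wave (xi l) eta.
split => //; rewrite rmorph_sum; apply: eq_bigr => l _.
by have [] := fourier_wave (xi l) eta.
Qed.

(** [cos (u - v) + v] has derivative [sin (u - v) + 1 >= 0] in [v]. This treats a small nonnegative
    change of phase as an additive error. *)
Lemma cos_sub_ge (u v : R) : 0 <= v -> cos u - v <= cos (u - v).
Proof.
move=> v0; pose g (v : R) := cos (u - v) + v.
have dg (x : R) : is_derive x 1 g (sin (u - x) + 1).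
  by rewrite /g; apply: is_derive_eq; rewrite /GRing.scale /=; ring.
have : g 0 <= g v.
  apply: (@ger0_derive1_le_cc _ g 0 v) => //.
  - move=> x _; rewrite derive1E (@derive_val _ _ _ _ _ _ _ (dg x)).
    by rewrite -lerBlDr sub0r sin_geN1.
  - by apply: continuous_subspaceT; exact: (is_derive1_continuous dg).
  - by rewrite in_itv /= lexx.
  - by rewrite in_itv /= v0 lexx.
by rewrite /g subr0 addr0 lerBlDr.
Qed.

Lemma Re_cint1_rot (alpha : R) (f : R -> R[i]) : cintegrable1 f ->
  complex.Re (cexpi (- alpha) * cint1 f) =
  Rintegral mu setT (fun x => complex.Re (cexpi (- alpha) * f x)).
Proof.
move=> [f1 f2]; rewrite Re_mulc /= cosN sinN mulNr opprK.
under [in RHS]eq_Rintegral do rewrite Re_mulc /= cosN sinN mulNr opprK.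
rewrite RintegralD//.
- by rewrite !RintegralZl.
- exact: (integrableZl measurableT (cos alpha) f1).
- exact: (integrableZl measurableT (sin alpha) f2).
Qed.

Definition gau_moment2 : R := Rintegral mu setT (fun x => x ^+ 2 * gau x).

Lemma integrable_sqr_gau : mu.-integrable setT (EFin \o (fun x : R => x ^+ 2 *
  gau x)).
Proof.
apply: (integrable_gauM (C := 1)); first exact: measurable_funX.
by move=> x; rewrite mul1r ger0_norm ?sqr_ge0// lerDr.
Qed.

Lemma integrable_translate (a : R) (f : R -> R) : measurable_fun setT f ->
  mu.-integrable setT (EFin \o (fun x => f (x + a))) ->
    mu.-integrable setT (EFin \o f).
Proof.
move=> mf i.
have ma : measurable_fun setT (fun x : measurableTypeR R => x +
  a : measurableTypeR R).
  exact: measurable_funD.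
have := @integrable_pushforward _ _ _ _ _ _ ma mu setT (EFin \o f) _ _ measurableT.
have mf' : measurable_fun setT (EFin \o f) by exact/measurable_EFinP.
rewrite preimage_setT => /(_ mf' i).
case/integrableP => m H; apply/integrableP; split => //.
apply: le_lt_trans H; rewrite le_eqVlt; apply/orP; left; apply/eqP.
by apply: eq_measure_integral => A mA _; exact/esym/lebesgue_measure_translate.
Qed.

(** Translating by [a] centres the Gaussian at the origin and re-expands the quadratic phase around
    [a]. *)
Lemma shift_cos_gau (a b c d : R) :
  mu.-integrable setT (EFin \o (fun x => cos (b * x ^+ 2 + c * x +
    d) * gau (x - a))) /\
  Rintegral mu setT (fun x => cos (b * x ^+ 2 + c * x + d) * gau (x - a)) =
  Rintegral mu setT (fun x => cos (b * x ^+ 2 + (2 * a * b + c) * x +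
    (b * a ^+ 2 + c * a + d)) * gau x).
Proof.
pose f x := cos (b * x ^+ 2 + c * x + d) * gau (x - a).
have mf : measurable_fun setT f.
  apply: measurable_funM; first exact: measurable_cos_quad.
  by apply: measurableT_comp; [exact: measurable_gau|exact: measurable_funD].
have E : (fun x => f (x + a)) =
  (fun x => cos (b * x ^+ 2 + (2 * a * b + c) * x + (b * a ^+ 2 + c * a +
    d)) * gau x).
  by apply/funext => x; rewrite /f addrK; congr (cos _ * _); ring.
have i : mu.-integrable setT (EFin \o (fun x => f (x + a))) by rewrite E;
  exact: integrable_cos_gau.
by split; [exact: integrable_translate i|rewrite -E; exact: Rintegral_translate].
Qed.

(** The integrand, in the frequency variable, of the evolution of one wave: [a] is the frequency of
    the wave, while [b = - 4 pi^2 t] and [c = 2 pi x] carry time and position. *)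
Definition chirp (a b c : R) (x : R) : R[i] :=
  (gau (x - a))%:C * cexpi (b * x ^+ 2 + c * x).

Lemma cintegrable1_chirp (a b c : R) : cintegrable1 (chirp a b c).
Proof.
split.
  have [+ _] := shift_cos_gau a b c 0.
  by congr (is_true (integrable _ _ (EFin \o _))); apply/funext => x;
    rewrite /chirp /cexpi Re_mulc /= mul0r subr0 mulrC addr0.
have [+ _] := shift_cos_gau a b c (- (pi / 2)).
by congr (is_true (integrable _ _ (EFin \o _))); apply/funext => x;
  rewrite /chirp /cexpi Im_mulc /= mul0r addr0 mulrC sin_cosBpihalf.
Qed.

Lemma Re_cint1_chirp (a b c alpha : R) : complex.Re (cexpi (- alpha) *
  cint1 (chirp a b c)) =
  Rintegral mu setT (fun x => cos (b * x ^+ 2 + (2 * a * b + c) * x +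
    (b * a ^+ 2 + c * a - alpha)) * gau x).
Proof.
rewrite Re_cint1_rot; last exact: cintegrable1_chirp.
have [_ <-] := shift_cos_gau a b c (- alpha).
apply: eq_Rintegral => x _.
rewrite /chirp mulrCA -cexpiD Re_mulc /= mul0r subr0 mulrC.
by congr (cos _ * _); ring.
Qed.

(** By [cos_sub_ge] the quadratic part of the phase lowers the cosine by at most [2 pi b x^2], which
    integrates to the second moment; the affine phase that remains is [gauFT]. *)
Lemma Rintegral_chirp_ge (b c d : R) : 0 <= b ->
  cos d * gau c - 2 * pi * b * gau_moment2 <=
  Rintegral mu setT (fun x => cos (- (2 * pi * b) * x ^+ 2 + (2 * pi * c) * x +
    d) * gau x).
Proof.
move=> b0; rewrite -gauFTE /gauFT /gau_moment2.
have i1 : mu.-integrable setT (EFin \o (fun x => cos (2 * pi * c * x + d) * gau x)).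
  have := integrable_cos_gau 0 (2 * pi * c) d.
  by under eq_fun do rewrite mul0r add0r.
have i2 := integrable_sqr_gau.
have i3 : mu.-integrable setT (EFin \o (fun x => 2 * pi * b * (x ^+ 2 * gau x))).
  exact: (integrableZl measurableT _ i2).
rewrite -RintegralZl// -RintegralB//.
apply: le_Rintegral => //.
- exact: (integrableB measurableT i1 i3).
- exact: integrable_cos_gau.
move=> x _; rewrite mulrA -mulrBl ler_wpM2r ?gau_ge0//.
rewrite (_ : - (2 * pi * b) * x ^+ 2 + 2 * pi * c * x + d =
  (2 * pi * c * x + d) - 2 * pi * b * x ^+ 2); last by ring.
apply: cos_sub_ge; apply: mulr_ge0; last exact: sqr_ge0.
by rewrite !mulr_ge0 ?pi_ge0.
Qed.

Lemma gau_moment2_ge0 : 0 <= gau_moment2.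
Proof. by apply: Rintegral_ge0 => x _; rewrite mulr_ge0 ?gau_ge0 ?sqr_ge0. Qed.

Lemma cosD_2pi_int (u : R) (z : int) : cos (u + 2 * pi * z%:~R) = cos u.
Proof.
have cosn (n : nat) (v : R) : cos (v + 2 * pi * n%:R) = cos v.
  by rewrite -(periodicn (@cosD2pi R) n v) mulr_natr mulr_natl.
case: z => n; first exact: cosn.
by rewrite NegzE mulrNz mulrN -[LHS](cosn n.+1) pmulrn subrK.
Qed.

(** Once the common phase [theta] is removed, every summand has real part at least [e^(-8) / 4], so
    nothing cancels. Here [tau] stands for [2 pi t], and [x - 2 tau xi] is the distance to the
    centre of a packet moving at speed [2 xi]. *)
Lemma packet_ge m (xi : 'I_m -> R) (x tau theta : R) (z : 'I_m ->
  int) (d : 'I_m -> R) :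
  (forall l, x * xi l - tau * xi l ^+ 2 = theta + (z l)%:~R + d l) ->
  (forall l, 0 <= d l <= 1 / 16) -> 0 <= tau ->
  (forall l, (x - 2 * tau * xi l) ^+ 2 <= 2) ->
  2 * pi * tau * gau_moment2 <= expR (- 8) / 4 ->
  m%:R * (expR (- 8) / 4) <=
  Normc.normc (cint1 (fun eta => \sum_l chirp (xi l) (- (2 * pi * tau)) (2 *
    pi * x) eta)).
Proof.
move=> hph hd tau0 hy hm.
have [|_ ->] := @cint1_sum _ (index_enum 'I_m) (fun l => chirp (xi l) (- (2 *
  pi * tau)) (2 * pi * x)).
  by move=> l; exact: cintegrable1_chirp.
set S := \sum_(l <- _) _.
(* A unimodular factor removes the common phase without changing the modulus. *)
have -> : Normc.normc S = Normc.normc (cexpi (- (2 * pi * theta)) * S).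
  by rewrite Normc.normcM normc_cexpi mul1r.
rewrite {}/S mulr_sumr.
have Rele (w : R[i]) : complex.Re w <= Normc.normc w.
  case: w => u v /=; rewrite (le_trans (ler_norm _))//
    -sqrtr_sqr ler_sqrt ?addr_ge0 ?sqr_ge0//.
  by rewrite lerDl sqr_ge0.
apply: le_trans (Rele _).
rewrite (big_morph (@complex.Re R) (id1 := 0) (op1 := +%R));
  [|exact: Re_addc|by []].
have -> : m%:R * (expR (- 8) / 4) = \sum_(l < m) (expR (- 8) / 4) :> R.
  by rewrite sumr_const card_ord mulr_natl.
apply: ler_sum => l _.
rewrite Re_cint1_chirp.
rewrite (_ : 2 * xi l * - (2 * pi * tau) + 2 * pi * x =
  2 * pi * (x - 2 * tau * xi l)); last by ring.
rewrite (_ : - (2 * pi * tau) * xi l ^+ 2 + 2 * pi * x * xi l - 2 * pi * theta =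
   2 * pi * d l + 2 * pi * (z l)%:~R); last first.
  have := hph l; move: (xi l) => X H.
  have -> : - (2 * pi * tau) * X ^+ 2 + 2 * pi * x * X - 2 * pi * theta =
   2 * pi * (x * X - tau * X ^+ 2 - theta) by ring.
  by rewrite H; ring.
apply: le_trans (Rintegral_chirp_ge _ _ tau0).
rewrite cosD_2pi_int.
have /andP[d0 d1] := hd l.
(* [d l <= 1 / 16] and [pi <= 4] give [1 - 2 pi d l >= 1 / 2]. With the Gaussian factor at least
   [e^(-8)], the main term is at least [e^(-8) / 2], and half of it pays for the moment. *)
have c1 : 1 / 2 <= cos (2 * pi * d l).
  have := @cos_sub_ge 0 (2 * pi * d l); rewrite sub0r cosN cos0.
  rewrite !mulr_ge0 ?pi_ge0//; move=> /(_ isT); apply: le_trans.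
  have := pi_le4; have := @pi_gt0 R; nra.
have g1 : expR (- 8) <= gau (x - 2 * tau * xi l).
  rewrite ler_expR lerN2; have := hy l; have := pi_le4; have := @pi_gt0 R.
  have := sqr_ge0 (x - 2 * tau * xi l); nra.
have e0 := expR_gt0 (- 8 : R).
nra.
Qed.

End packets.

(** * The initial datum on R^n and its evolution as tensor products *)

Section tensor_packets.
Context {R : realType}.
Local Notation mu := (@lebesgue_measure R).

Definition tensor_packet n m (xi : 'I_n -> 'I_m -> R) (x : 'rV[R]_n) : R[i] :=
  \prod_j packet (xi j) (x ord0 j).

Lemma schwartz_tensor_packet n m (xi : 'I_n -> 'I_m ->
  R) : schwartz (tensor_packet xi).
Proof.
apply: (@schwartz_prod _ _ (fun j k x => \sum_l wave_jet (2 * pi *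
  xi j l) k x)) => j.
by apply: schwartz_jet_sum => l; exact: schwartz_wave_jet.
Qed.

Lemma cexpi_sum (I : finType) (f : I -> R) : cexpi (\sum_i f i) =
  \prod_i cexpi (f i).
Proof.
apply: (big_morph (@cexpi R)); first exact: cexpiD.
by rewrite /cexpi cos0 sin0.
Qed.

Lemma fourier_tensor_packet n m (xi : 'I_n -> 'I_m -> R) (eta : 'rV[R]_n) :
  fourier (tensor_packet xi) eta = (\prod_j \sum_l gau (eta ord0 j - xi j l))%:C.
Proof.
rewrite /fourier.
have -> : (fun x => tensor_packet xi x * cexpi (- (2 * pi * dotmul x eta))) =
  (fun x : 'rV[R]_n => \prod_j (packet (xi j) (x ord0 j) * cexpi (- (2 * pi *
    (x ord0 j * eta ord0 j))))).
  by apply/funext => x; rewrite /dotmul mulr_sumr -sumrN cexpi_sum -big_split.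
rewrite (@cintegral_prod_rV _ _ (fun j x => packet (xi j) x * cexpi (- (2 *
  pi * (x * eta ord0 j))))).
  rewrite rmorph_prod; apply: eq_bigr => j _.
  by have [] := fourier_packet (xi j) (eta ord0 j).
by move=> j; have [] := fourier_packet (xi j) (eta ord0 j).
Qed.

Lemma sqr_enorm n (x : 'rV[R]_n) : enorm x ^+ 2 = \sum_j x ord0 j ^+ 2.
Proof.
rewrite sqr_sqrtr; first by apply: eq_bigr => j _; rewrite expr2.
by apply: sumr_ge0 => j _; rewrite -expr2 sqr_ge0.
Qed.

(** Both [dotmul] and the square of [enorm] are sums over coordinates, so the exponential factors
    and the integral splits. *)
Lemma schrodinger_tensor_packet n m (xi : 'I_n -> 'I_m ->
  R) (t : R) (x : 'rV[R]_n) :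
  schrodinger t (tensor_packet xi) x =
  \prod_j cint1 (fun eta => \sum_l chirp (xi j l) (- (2 * pi * (2 * pi *
    t))) (2 * pi * x ord0 j) eta).
Proof.
rewrite /schrodinger.
have -> : (fun eta => fourier (tensor_packet xi) eta *
    cexpi (2 * pi * dotmul x eta - 4 * pi ^+ 2 * t * enorm eta ^+ 2)) =
  (fun eta : 'rV[R]_n => \prod_j
     \sum_l chirp (xi j l) (- (2 * pi * (2 * pi * t))) (2 * pi *
       x ord0 j) (eta ord0 j)).
  apply/funext => eta; rewrite fourier_tensor_packet sqr_enorm /dotmul !mulr_sumr.
  rewrite -sumrN -big_split /= cexpi_sum rmorph_prod -big_split /=.
  apply: eq_bigr => j _; rewrite rmorph_sum mulr_suml; apply: eq_bigr => l _.
  by rewrite /chirp; congr (_ * cexpi _); ring.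
rewrite (@cintegral_prod_rV _ _ (fun j eta => \sum_l chirp (xi j l) (- (2 *
  pi * (2 * pi * t))) (2 * pi * x ord0 j) eta))//.
move=> j.
have [] // := @cint1_sum _ _ (index_enum 'I_m) (fun l => chirp (xi j l) (- (2 *
  pi * (2 * pi * t))) (2 * pi * x ord0 j)).
by move=> l; exact: cintegrable1_chirp.
Qed.

End tensor_packets.

(** * Lower bound for the L^2 norm over the ball *)

Section L2_bounds.
Context {R : realType}.
Local Notation mu := (@lebesgue_measure R).

(** The integral is a supremum over the simple functions below the integrand, a family that grows
    with it; so the comparison can be applied to the maximal function. *)
Lemma ge0_le_integralT d (T : measurableType d) (nu : {measure set T ->
  \bar R}) (f g : T -> \bar R) :
  (forall x, 0 <= f x)%E -> (forall x, f x <= g x)%E ->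
  (\int[nu]_x f x <= \int[nu]_x g x)%E.
Proof.
move=> f0 fg; rewrite !ge0_integralTE//; last by move=> x; exact: le_trans (fg x).
apply: ereal_sup_le => _ [h hf <-]; exists h => // x.
exact: le_trans (fg x).
Qed.

Lemma prod_cst_EFin n (a : R) : (\prod_(i < n) a%:E)%E = (a ^+ n)%:E.
Proof.
by elim: n => [|n IH]; [rewrite big_ord0 expr0|rewrite big_ord_recl IH exprS EFinM].
Qed.

Lemma Lnorm2E d (T : measurableType d) (nu : {measure set T ->
  \bar R}) (f : T -> \bar R) :
  ('N[nu]_2%:E[f] = (\int[nu]_x (`|f x| `^ 2)) `^ (2^-1))%E.
Proof. by rewrite unlock. Qed.

(* [g] need not be measurable, so its integral is only compared with that of a
   constant on a box contained in the ball. *)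
Lemma L2norm_on_ball_ge n (g : 'rV[R]_n -> \bar R) (lam : R) : 0 <= lam ->
  (forall x, unit_ball x -> (lam%:E <= g x)%E) ->
  ((lam ^+ 2 * (n.+1%:R^-1) ^+ n)%:E `^ (2^-1) <= L2norm_on (@unit_ball R n) g)%E.
Proof.
move=> lam0 hg; rewrite /L2norm_on Lnorm2E.
(* With this side, points of the cube have squared norm at most [n / (n + 1) < 1]. *)
pose r : R := n.+1%:R^-1.
have r0 : 0 < r by rewrite invr_gt0 ltr0n.
pose Q : set 'rV[R]_n := [set x | forall i : 'I_n, `[0, r]%classic (x ord0 i)].
have mQ : measurable Q.
  have -> : Q = \bigcap_(i in [set: 'I_n]) (@rV_coord R n i @^-1` `[0, r]%classic).
    by apply/seteqP; split => [x Bx i _|x Bx i]; exact: Bx.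
  apply: fin_bigcap_measurable => // i _; rewrite -[X in measurable X]setTI.
  by apply: measurable_rV_coord => //; exact: measurable_itv.
have muQ : lebesgue_rV R n Q = (r ^+ n)%:E.
  rewrite (@lebesgue_rV_box R n (fun=> `[0, r]%classic)); last by move=> i;
    exact: measurable_itv.
  rewrite (eq_bigr (fun=> r%:E)); first exact: prod_cst_EFin.
  by move=> i _; rewrite lebesgue_measure_itv /= lte_fin r0 oppr0 adde0.
have QB : Q `<=` @unit_ball R n.
  move=> x Qx; rewrite /unit_ball /= -(@ltr_pXn2r _ 2) ?nnegrE ?sqrtr_ge0//
    expr1n sqr_enorm.
  apply: (@le_lt_trans _ _ (\sum_(j < n) r)).
    apply: ler_sum => j _; have := Qx j; rewrite /= in_itv /= => /andP[x0 xr].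
    have : r <= 1 by rewrite invf_le1 ?ltr0n// ler1n.
    nra.
  rewrite sumr_const card_ord -mulr_natr ltr_pdivrMl ?ltr0n// mulr1.
  by rewrite ltr_nat.
apply: gt0_ler_poweR; rewrite ?invr_ge0//.
- by rewrite in_itv/= leey andbT lee_fin mulr_ge0 ?sqr_ge0// exprn_ge0// ltW.
- by rewrite in_itv /= leey andbT; apply: integral_ge0 => x _; exact: poweR_ge0.
rewrite -/r EFinM -muQ -integral_cst// integral_mkcond.
apply: ge0_le_integralT => x; rewrite patchE; case: ifPn => // xQ.
- by rewrite lee_fin sqr_ge0.
- rewrite patchE ifT; last by rewrite inE; apply: QB; rewrite inE in xQ.
  have gx : (lam%:E <= `|g x|)%E.
    by apply: le_trans (lee_abs _); apply: hg; apply: QB; rewrite inE in xQ.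
  have -> : (lam ^+ 2)%:E = (lam%:E `^ 2)%E by rewrite poweR_EFin powR_mulrn.
  by apply: gt0_ler_poweR; rewrite // in_itv /= leey andbT// lee_fin.
- exact: poweR_ge0.
Qed.

End L2_bounds.

(** * Upper bound for the Sobolev norm of a packet *)

Section sobolev_bound.
Context {R : realType}.
Local Notation mu := (@lebesgue_measure R).

(** From [(1 + v) e^(-v) <= 1] with [v = pi x^2], and [pi >= 2]. *)
Lemma gau_sqr_le1 (x : R) : x ^+ 2 * gau x <= 1 / 2.
Proof.
have p2 := @pi_ge2 R; have e0 := gau_gt0 x; have x2 := sqr_ge0 x.
have : (1 + pi * x ^+ 2) * gau x <= 1.
  apply: le_trans (ler_wpM2r (ltW e0) (expR_ge1Dx _)) _.
  by rewrite expRxMexpNx_1.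
nra.
Qed.

(* Of two points at distance [D], one is at distance [D / 2] from the origin. *)
Lemma gau_mul_le (D2 p q : R) : 0 < D2 -> D2 <= (p - q) ^+ 2 ->
  gau p * gau q <= 2 / D2 * (gau p + gau q).
Proof.
move=> D0 Dpq.
have half a : D2 <= 4 * a ^+ 2 -> gau a <= 2 / D2.
  move=> h; rewrite ler_pdivlMr//; have := gau_sqr_le1 a; have := gau_ge0 a; nra.
have p0 := gau_ge0 p; have q0 := gau_ge0 q; have d0 : 0 <= 2 / D2 by rewrite
  divr_ge0// ltW.
have [h|h] := leP D2 (4 * p ^+ 2).
  have := half p h; nra.
have : D2 <= 4 * q ^+ 2 by have := sqr_ge0 (p + q); nra.
move=> /half; nra.
Qed.

(** Almost orthogonality. With [S] the sum, the diagonal terms contribute at most [S] because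
    [gau <= 1]; by [gau_mul_le] the others contribute at most [(4 m / D2) S <= S]. *)
Lemma sum_gau_sqr_le m (xi : 'I_m -> R) (D2 eta : R) :
  0 < D2 -> 4 * m%:R <= D2 ->
  (forall l l', l != l' -> D2 <= (xi l - xi l') ^+ 2) ->
  (\sum_l gau (eta - xi l)) ^+ 2 <= 2 * \sum_l gau (eta - xi l).
Proof.
move=> D0 mD sep; set a := fun l => gau (eta - xi l).
have g1 (x : R) : gau x <= 1 by rewrite -expR0 ler_expR oppr_le0 mulr_ge0 ?pi_ge0
  ?sqr_ge0.
have aa l l' : a l * a l' <= (if l' == l then a l else 0) + 2 / D2 * (a l + a l').
  have d0 : 0 <= 2 / D2 * (a l + a l') by rewrite mulr_ge0 ?divr_ge0 ?addr_ge0
    ?gau_ge0// ltW.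
  case: eqVneq d0 => [->|ll'] d0.
    by apply: ler_wpDr => //; apply: ler_piMr; [exact: gau_ge0|exact: g1].
  rewrite add0r gau_mul_le//; have := sep _ _ ll'.
  by congr (_ <= _ ^+ 2); ring.
have cst (c : R) : \sum_(l < m) c = m%:R * c by rewrite sumr_const card_ord
  mulr_natl.
have S0 : 0 <= \sum_l a l by apply: sumr_ge0 => l _; exact: gau_ge0.
set k := 2 / D2 in aa.
have km : 2 * (k * m%:R) <= 1.
  rewrite /k mulrAC mulrA ler_pdivrMr// mul1r; apply: le_trans mD.
  by rewrite mulrA -natrM.
apply: (@le_trans _ _ (\sum_l (a l + k * (m%:R * a l + \sum_l' a l')))).
  rewrite expr2 mulr_suml; apply: ler_sum => l _; rewrite mulr_sumr.
  apply: le_trans (ler_sum _ (fun l' _ => aa l l')) _.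
  by rewrite big_split /= -big_mkcond /= big_pred1_eq lerD2l -mulr_sumr big_split
    /= cst.
rewrite big_split /= -mulr_sumr big_split /= -mulr_sumr cst.
move: (\sum_l a l) S0 => S S0; nra.
Qed.

(** The outer 2 comes from [sum_gau_sqr_le]; the bracket is the integral of [(3 + 2 u^2) gau u],
    which dominates each recentred Gaussian with its weight. *)
Definition weight_const : R := 2 * (3 + 2 * gau_moment2).

(** Each Gaussian is translated to the origin; as [|xi l| <= B] and [B >= 1], the translated weight
    is at most [3 + 2 u^2], uniformly in [B]. *)
Lemma weighted_packet_integral m (xi : 'I_m -> R) (B : R) :
  1 <= B -> (forall l, `|xi l| <= B) ->
  mu.-integrable setT (EFin \o (fun u => (1 + u ^+ 2 / B ^+ 2) * (2 *
    \sum_l gau (u - xi l)))) /\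
  \int[mu]_u ((1 + u ^+ 2 / B ^+ 2) * (2 * \sum_l gau (u - xi l))) <=
    weight_const * m%:R.
Proof.
move=> B1 xiB; have B0 : 0 < B by exact: lt_le_trans B1.
pose f l u := (1 + u ^+ 2 / B ^+ 2) * gau (u - xi l).
have wle (l : 'I_m) (u : R) : 1 + (u + xi l) ^+ 2 / B ^+ 2 <= 3 + 2 * u ^+ 2.
  have h : (xi l) ^+ 2 <= B ^+ 2 by rewrite -[leLHS]real_normK ?num_real//
    lerXn2r ?nnegrE// ltW.
  have h2 : 1 <= B ^+ 2 by rewrite exprn_ege1.
  rewrite -lerBrDl ler_pdivrMr ?exprn_gt0//.
  have := sqr_ge0 (u - xi l); have := sqr_ge0 u; nra.
have mw (a : R) : measurable_fun setT (fun u : R => 1 + (u + a) ^+ 2 / B ^+ 2).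
  apply: measurable_funD => //; apply: measurable_funM => //.
  by apply: measurable_funX; exact: measurable_funD.
have mf l : measurable_fun setT (f l).
  apply: measurable_funM.
    by have := mw 0; under eq_fun do rewrite addr0.
  by apply: measurableT_comp; [exact: measurable_gau|exact: measurable_funD].
have sh l : (fun u => f l (u + xi l)) = (fun u => (1 + (u +
  xi l) ^+ 2 / B ^+ 2) * gau u).
  by apply/funext => u; rewrite /f addrK.
have ish l : mu.-integrable setT (EFin \o (fun u => f l (u + xi l))).
  rewrite sh; apply: (integrable_gauM (C := 3)); first exact: mw.
  move=> u; rewrite ger0_norm ?addr_ge0 ?divr_ge0 ?sqr_ge0//.
  by apply: le_trans (wle l u) _; have := sqr_ge0 u; lra.
have iF l := integrable_translate (mf l) (ish l).
have If l : Rintegral mu setT (f l) <= 3 + 2 * gau_moment2.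
  rewrite (Rintegral_translate (mf l) (ish l)) sh.
  have i1 : mu.-integrable setT (EFin \o (fun u : R => 3 * gau u)).
    by have := integrableZl measurableT 3 (@integrable_gau R).
  have i2 : mu.-integrable setT (EFin \o (fun u : R => 2 * (u ^+ 2 * gau u))).
    by have := integrableZl measurableT 2 (@integrable_sqr_gau R).
  have -> : 3 + 2 * gau_moment2 = Rintegral mu setT (fun u : R => 3 * gau u +
    2 * (u ^+ 2 * gau u)).
    rewrite RintegralD// !RintegralZl ?Rintegral_gau ?mulr1//.
    - exact: integrable_sqr_gau.
    - exact: integrable_gau.
  apply: le_Rintegral => //.
  - by have := ish l; rewrite sh.
  - by have := integrableD measurableT i1 i2.
  by move=> u _; rewrite mulrA -mulrDl ler_wpM2r ?gau_ge0.
have sum_i (r : seq 'I_m) : mu.-integrable setT (EFin \o (fun u => \sum_(l <- r)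
  f l u)) /\
    Rintegral mu setT (fun u => \sum_(l <- r) f l u) =
      \sum_(l <- r) Rintegral mu setT (f l).
  elim: r => [|l r [IH1 IH2]].
    rewrite big_nil (_ : (fun u => _) = cst 0); last by apply/funext => u;
      rewrite big_nil.
    by split; [exact: integrable0|rewrite /Rintegral integral0].
  rewrite (_ : (fun u => _) = (fun u => f l u + \sum_(l <- r) f l u));
    last by apply/funext => u; rewrite big_cons.
  split; first by have := integrableD measurableT (iF l) IH1.
  by rewrite RintegralD// big_cons IH2.
have E : (fun u => (1 + u ^+ 2 / B ^+ 2) * (2 * \sum_l gau (u - xi l))) =
  (fun u => 2 * \sum_l f l u).
  by apply/funext => u; rewrite mulrCA -mulr_sumr.
have [j1 j2] := sum_i (index_enum 'I_m).
rewrite E; split; first by have := integrableZl measurableT 2 j1.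
rewrite RintegralZl// j2 /weight_const -mulrA ler_wpM2l//.
apply: le_trans (ler_sum _ (fun l _ => If l)) _.
by rewrite sumr_const card_ord mulr_natr.
Qed.

(** Used to dominate the weight [1 + |xi|^2] by a tensor product. *)
Lemma prod1D_ge (I : Type) (r : seq I) (y : I -> R) : (forall i, 0 <= y i) ->
  1 + \sum_(i <- r) y i <= \prod_(i <- r) (1 + y i).
Proof.
move=> y0; elim: r => [|i r IH]; first by rewrite !big_nil addr0.
rewrite !big_cons; have := y0 i; have : 0 <= \sum_(j <- r) y j by apply: sumr_ge0.
nra.
Qed.

Lemma normc_real (x : R) : Normc.normc x%:C = `|x|.
Proof. by rewrite /= expr0n addr0 sqrtr_sqr. Qed.

(** Let [P] be the product of the [1 + x_j^2 / B^2]. The weight is at most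
    [(B^2 P)^sg <= B^(2 sg) P], because [P >= 1] and [sg <= 1]; with [sum_gau_sqr_le] in each
    coordinate the integrand is dominated by a tensor product. *)
Lemma sobolev_norm_tensor_packet_le n m (xi : 'I_n -> 'I_m -> R) (B D2 s sg : R) :
  1 <= B -> (forall j l, `|xi j l| <= B) ->
  0 < D2 -> 4 * m%:R <= D2 ->
  (forall j l l', l != l' -> D2 <= (xi j l - xi j l') ^+ 2) ->
  s <= sg -> 0 <= sg <= 1 ->
  (sobolev_norm s (tensor_packet xi) <=
    (B `^ (2 * sg) * (weight_const * m%:R) ^+ n)%:E `^ (2^-1))%E.
Proof.
move=> B1 xiB D0 mD sep ssg /andP[sg0 sg1].
have B0 : 0 < B by exact: lt_le_trans B1.
rewrite /sobolev_norm Lnorm2E.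
pose w j u := (1 + u ^+ 2 / B ^+ 2) * (2 * \sum_l gau (u - xi j l)).
have iw j : mu.-integrable setT (EFin \o w j) by have [] :=
  weighted_packet_integral B1 (xiB j).
have Iw j : Rintegral mu setT (w j) <= weight_const *
  m%:R by have [] := weighted_packet_integral B1 (xiB j).
have S0 j u : 0 <= \sum_l gau (u - xi j l) by apply: sumr_ge0 => l _;
  exact: gau_ge0.
have y0 (u : R) : 0 <= u ^+ 2 / B ^+ 2 by rewrite divr_ge0 ?sqr_ge0.
have w0 j u : 0 <= w j u by rewrite !mulr_ge0 ?addr_ge0.
have [iP IP] := Rintegral_prod_rV iw.
have Bs : 0 <= B `^ (2 * sg) by exact: powR_ge0.
apply: gt0_ler_poweR; rewrite ?invr_ge0//.
- by rewrite in_itv /= leey andbT; apply: integral_ge0 => x _; rewrite lee_fin;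
  exact: powR_ge0.
- rewrite in_itv /= leey andbT lee_fin mulr_ge0// exprn_ge0// mulr_ge0//.
  by rewrite mulr_ge0// addr_ge0// mulr_ge0// gau_moment2_ge0.
apply: (@le_trans _ _ (\int[lebesgue_rV R n]_x (B `^ (2 * sg) *
  \prod_j w j (x ord0 j))%:E)%E); last first.
  under eq_integral do rewrite EFinM.
  rewrite integralZl// EFinM lee_wpmul2l ?lee_fin//.
  rewrite -[X in (X <= _)%E]fineK; last exact: integrable_fin_num.
  rewrite lee_fin -/(Rintegral _ _ _) IP.
  rewrite -[n in leRHS]card_ord -prodr_const.
  apply: ler_prod => j _; rewrite Iw andbT.
  by apply: Rintegral_ge0 => u _.
apply: ge0_le_integralT => x; first exact: poweR_ge0.
rewrite abse_EFin poweR_EFin powR_mulrn// lee_fin real_normK ?num_real//.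
rewrite exprMn fourier_tensor_packet normc_real real_normK ?num_real//.
have -> : ((1 + enorm x ^+ 2) `^ (s / 2)) ^+ 2 = (1 + enorm x ^+ 2) `^ s.
  by rewrite -powR_mulrn ?powR_ge0// -powRrM divfK.
have e1 : 1 <= 1 + enorm x ^+ 2 by rewrite lerDl sqr_ge0.
pose P := \prod_j (1 + x ord0 j ^+ 2 / B ^+ 2).
have P1 : 1 <= P.
  apply: le_trans (prod1D_ge _ _) => //.
  by rewrite lerDl; apply: sumr_ge0.
have P0 : 0 <= P by exact: le_trans P1.
have eP : 1 + enorm x ^+ 2 <= B ^+ 2 * P.
  apply: (@le_trans _ _ (B ^+ 2 * (1 + \sum_j x ord0 j ^+ 2 / B ^+ 2))).
    rewrite mulrDr mulr1 -mulr_suml mulrCA divff ?gt_eqF ?exprn_gt0//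
      mulr1 sqr_enorm.
    by rewrite lerD2r exprn_ege1.
  by rewrite ler_wpM2l ?sqr_ge0//; apply: prod1D_ge.
have h : (1 + enorm x ^+ 2) `^ s <= B `^ (2 * sg) * P.
  apply: (le_trans (ler_powR e1 ssg)).
  apply: (@le_trans _ _ ((B ^+ 2 * P) `^ sg)).
    apply: ge0_ler_powR => //; rewrite nnegrE.
    - exact: le_trans e1.
    - by rewrite mulr_ge0 ?sqr_ge0.
  rewrite powRM ?sqr_ge0// -(powR_mulrn 2 (ltW B0)) -powRrM.
  apply: ler_wpM2l; first exact: powR_ge0.
  by rewrite -[leRHS]powRr1// ler_powR.
apply: (le_trans (ler_wpM2r (sqr_ge0 _) h)).
rewrite -mulrA ler_wpM2l// -prodrXl -big_split /=.
apply: ler_prod => j _; rewrite mulr_ge0 ?addr_ge0 ?sqr_ge0//=.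
rewrite ler_wpM2l ?addr_ge0//.
exact: (sum_gau_sqr_le _ D0 mD (sep j)).
Qed.

End sobolev_bound.

(** * Choice of the time by digits, and lower bound for the maximal function *)

Section counterexample.
Context {R : realType}.

(** The digits of [k] are found one at a time: a new digit [d] of weight [L^n] changes the earlier
    quotients [k / L^(j+1)], [j < n], by integers, and the quotient with [j = n] by [d / L]. *)
Lemma digits (L : nat) (L0 : (0 < L)%N) (n : nat) (y : nat -> R) :
  exists2 k : nat, (k < L ^ n)%N & forall j, (j < n)%N -> exists z : int,
    0 <= y j - k%:R / L%:R ^+ j.+1 - z%:~R <= L%:R^-1.
Proof.
have Lr : (0 : R) < L%:R by rewrite ltr0n.
elim: n => [|n [k kn IH]]; first by exists 0%N.
pose u := y n - k%:R / L%:R ^+ n.+1.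
(* The last base-[L] digit of [q] becomes the new digit of [k] and the quotient becomes [z]; the
   error left is the fractional part of [L u] divided by [L]. *)
pose q := Num.floor (L%:R * u).
pose d := `|(q %% L)%Z|%N.
have dq : (d%:Z = (q %% L)%Z) by rewrite /d gez0_abs// modz_ge0// -lt0n.
have dL : (d < L)%N by rewrite -ltz_nat dq ltz_pmod.
exists (k + d * L ^ n)%N.
  rewrite expnS; apply: (@leq_trans (L ^ n + d * L ^ n));
    first by rewrite ltn_add2r.
  by rewrite -mulSn leq_mul2r dL orbT.
move=> j; rewrite ltnS leq_eqVlt => /orP[/eqP ->|jn].
  exists (q %/ L)%Z.
  have -> : y n - (k + d * L ^ n)%:R / L%:R ^+ n.+1 - (q %/ L)%Z%:~R =
      (L%:R * u - q%:~R) / L%:R.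
    have -> : q%:~R = (q %/ L)%Z%:~R * L%:R + d%:R :> R.
      by rewrite {1}(divz_eq q L) -dq intrD intrM.
    rewrite natrD natrM natrX /u exprS; field.
    by rewrite !gt_eqF ?exprn_gt0.
  have /andP[q1 q2] := floor_itv (L%:R * u).
  rewrite divr_ge0 ?subr_ge0 ?ler0n//= ler_pdivrMr// mulVf ?gt_eqF//.
  by move: q2; rewrite intrD -/q => q2; rewrite lerBlDr addrC ltW.
have [z hz] := IH j jn.
exists (z - (d * L ^ (n - j.+1))%N%:Z).
have -> : y j - (k + d * L ^ n)%:R / L%:R ^+ j.+1 - (z - (d *
  L ^ (n - j.+1))%N%:Z)%:~R =
   y j - k%:R / L%:R ^+ j.+1 - z%:~R.
  rewrite intrB -pmulrn -{1}(subnK jn) expnD natrD !natrM !natrX.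
  by field; rewrite !gt_eqF ?exprn_gt0.
exact: hz.
Qed.

(** Adding [L^n] moves every [k / L^(j+1)] with [j < n] by an integer, and makes [k], hence the
    time, positive. *)
Lemma digits_shifted (L : nat) (L0 : (0 < L)%N) (n : nat) (y : nat -> R) :
  exists2 k : nat, (L ^ n <= k < 2 * L ^ n)%N & forall j, (j < n)%N ->
    exists z : int,
    0 <= y j - k%:R / L%:R ^+ j.+1 - z%:~R <= L%:R^-1.
Proof.
have [k kn H] := digits L0 n y; exists (L ^ n + k)%N.
  by rewrite leq_addr mul2n -addnn ltn_add2l.
have Lr : (0 : R) < L%:R by rewrite ltr0n.
move=> j jn; have [z hz] := H j jn; exists (z - (L ^ (n - j.+1))%N%:Z).
have -> : y j - (L ^ n + k)%:R / L%:R ^+ j.+1 - (z - (L ^ (n - j.+1))%N%:Z)%:~R =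
   y j - k%:R / L%:R ^+ j.+1 - z%:~R; last exact: hz.
rewrite intrB -pmulrn -{1}(subnK jn) expnD natrD !natrM !natrX.
by field; rewrite !gt_eqF ?exprn_gt0.
Qed.

(* [D (l + a_j / 2)]; coordinates are numbered from 0, hence the exponent
   [j.+1] in [a_j]. *)
Definition lattice_freq n m (j : 'I_n) (l : 'I_m) : R :=
  (16 * m)%:R ^+ n.+1 * (l%:R + (16 * m)%:R ^- j.+1 / 2).

Lemma schrodinger_max_ge n m (x : 'rV[R]_n) : (0 < m)%N -> (0 < n)%N ->
  4 * pi * gau_moment2 <= expR (- 8) / 4 * (m%:R : R) ->
  unit_ball x ->
  (((m%:R * (expR (- 8) / 4)) ^+ n)%:E <= schrodinger_max (tensor_packet
    (@lattice_freq n m)) x)%E.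
Proof.
move=> m0 n0 hm xB.
have L0 : (0 < 16 * m)%N by rewrite muln_gt0.
set L := (16 * m)%N in L0 *.
have Lr : (0 : R) < L%:R by rewrite ltr0n.
have L1 : (1 : R) <= L%:R by rewrite ler1n.
have mr1 : (1 : R) <= m%:R by rewrite ler1n.
have LE : L%:R = 16 * m%:R :> R by rewrite natrM.
pose D : R := L%:R ^+ n.+1.
have D0 : 0 < D by rewrite exprn_gt0.
(* [digits_shifted] takes a sequence over all naturals; the value 0 outside the coordinates is a
   filler. *)
pose y (j : nat) : R := D * (if insub j is Some i then x ord0 i else 0).
have [k /andP[k1 k2] hk] := digits_shifted L0 n y.
have k1r : L%:R ^+ n <= k%:R :> R by rewrite -natrX ler_nat.
have k2r : k%:R <= 2 * L%:R ^+ n :> R by rewrite -natrX -natrM ler_nat ltnW.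
pose tau : R := k%:R / D ^+ 2.
have Ln0 : 0 < L%:R ^+ n :> R by rewrite exprn_gt0.
have tau0 : 0 < tau by rewrite divr_gt0 ?exprn_gt0// (lt_le_trans Ln0).
have DE : D = L%:R * L%:R ^+ n by rewrite /D exprS.
have tauD : tau * D <= 2 / L%:R.
  rewrite /tau expr2 invfM mulrA divfK ?gt_eqF// ler_pdivrMr//
    DE mulrA divfK ?gt_eqF//.
(* This bound gives both [t < 1] and, combined with [hm], the smallness of the moment term. *)
have taum : tau * m%:R <= 2.
  apply: le_trans (_ : tau * D <= _); last first.
    by apply: (le_trans tauD); rewrite ler_pdivrMr//; lra.
  rewrite ler_wpM2l ?ltW// DE.
  have : 1 <= L%:R ^+ n :> R by rewrite exprn_ege1.
  by nra.
pose t := tau / (2 * pi).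
have p2 := @pi_ge2 R; have p0 := @pi_gt0 R.
have p20 : 0 < 2 * pi :> R by rewrite mulr_gt0.
have tE : 2 * pi * t = tau by rewrite /t mulrC divfK// gt_eqF.
have small : 2 * pi * tau * gau_moment2 <= expR (- 8) / 4.
  rewrite -(ler_pM2r (lt_le_trans ltr01 mr1)); apply: le_trans hm.
  have := gau_moment2_ge0 (R := R); have := ltW p0.
  move: (gau_moment2) => G P0 G0.
  have := mulr_ge0 P0 G0; nra.
apply: le_trans (_ : ((Normc.normc (schrodinger t (tensor_packet (@lattice_freq n
  m)) x))%:E <= _)%E); last first.
  apply: ereal_sup_ubound; exists t => //=; rewrite divr_gt0//=.
  rewrite ltr_pdivrMr// mul1r; have := ler_wpM2l (ltW tau0) mr1; lra.
rewrite lee_fin schrodinger_tensor_packet normc_prod tE.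
rewrite -[n in leLHS]card_ord -prodr_const; apply: ler_prod => j _.
apply/andP; split; first by rewrite mulr_ge0 ?divr_ge0 ?expR_ge0.
have yE : y j = D * x ord0 j by rewrite /y valK.
have [z] := hk j (ltn_ord j); rewrite yE.
set al : R := L%:R ^- j.+1.
set del := D * x ord0 j - _ - _ => /andP[del0 del1].
have xE : x ord0 j = (k%:R * al + z%:~R + del) / D.
  by rewrite /del -/al; field; rewrite gt_eqF.
have al0 : 0 <= al by rewrite invr_ge0 exprn_ge0// ltW.
have al1 : al <= 1 by rewrite invf_le1 ?exprn_gt0// exprn_ege1.
have x1 : x ord0 j ^+ 2 <= 1.
  move: xB; rewrite /unit_ball /= -(@ltr_pXn2r _ 2) ?nnegrE ?sqrtr_ge0//
    expr1n sqr_enorm.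
  move/ltW; apply: le_trans; rewrite (bigD1 j)//= lerDl.
  by apply: sumr_ge0 => i _; exact: sqr_ge0.
have freqE (l : 'I_m) : lattice_freq j l = D * (l%:R +
  al / 2) by rewrite /lattice_freq -/L -/D -/al.
pose om := D * al / 2.
(* As [tau * D ^+ 2 = k], the part of the phase depending on [l] is [l (D x - k al) - k l^2], and
   [D x - k al = z + del]. The offset [al / 2] of the frequency produces the term [k al l] as a
   cross term of the square. *)
apply: (@packet_ge _ _ _ _ _ (x ord0 j * om - tau * om ^+ 2)
  (fun l => (l%:Z * z - (k * l ^ 2)%N%:Z)) (fun l => l%:R * del)) => //.
- move=> l; rewrite freqE /om intrB intrM -!pmulrn natrM natrX xE /tau.
  by field; rewrite gt_eqF.
(* [l * del <= m / L = 1 / 16]: this fixes the factor 16 in [L]. *)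
- move=> l; rewrite mulr_ge0//=.
  have lm : (l%:R : R) <= m%:R by rewrite ler_nat ltnW.
  apply: le_trans (ler_pM _ del0 lm del1) _ => //.
  by rewrite LE invfM mulrCA divff ?mulr1 ?mul1r// gt_eqF// (lt_le_trans ltr01).
- exact: ltW.
- move=> l; rewrite freqE.
  have lm : (l%:R : R) + 1 <= m%:R by rewrite natr1 ler_nat.
  have l0 : 0 <= l%:R :> R by [].
  have f1 : l%:R + al / 2 <= m%:R by lra.
  have b0 : 0 <= tau * (D * (l%:R + al / 2)).
    apply: mulr_ge0; first exact: ltW.
    by apply: mulr_ge0; [exact: ltW|rewrite addr_ge0 ?divr_ge0].
  (* The packet travels at most [1 / 4], so its distance to [x] is at most [5 / 4], whose square is
     below 2. *)
  have b1 : tau * (D * (l%:R + al / 2)) <= 1 / 8.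
    rewrite mulrA; apply: (le_trans (ler_pM _ _ tauD f1)).
    - by apply: mulr_ge0; exact: ltW.
    - by rewrite addr_ge0 ?divr_ge0.
    have m1 : (0 : R) < m%:R by exact: lt_le_trans mr1.
    by rewrite LE le_eqVlt; apply/orP; left; apply/eqP; field; rewrite gt_eqF.
  have : `|x ord0 j| <= 1 by rewrite -(@ler_pXn2r _ 2) ?nnegrE//
    expr1n real_normK ?num_real.
  rewrite ler_norml => /andP[xm xp].
  rewrite -mulrA; nra.
Qed.

End counterexample.

(** * The maximal estimate applied to the packet *)

Section counterexample_norm.
Context {R : realType}.

Lemma lattice_freq_norm n m (j : 'I_n) (l : 'I_m) : (0 < m)%N ->
  `|lattice_freq j l : R| <= (16 * m)%:R ^+ n.+2.
Proof.
move=> m0; have L0 : (0 < 16 * m)%N by rewrite muln_gt0.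
have Lr : (0 : R) < (16 * m)%:R by rewrite ltr0n.
have al0 : 0 <= (16 * m)%:R ^- j.+1 :> R by rewrite invr_ge0 exprn_ge0// ltW.
have al1 : (16 * m)%:R ^- j.+1 <= 1 :> R.
  by rewrite invf_le1 ?exprn_gt0// exprn_ege1// ler1n.
have lm : (l%:R : R) + 1 <= m%:R by rewrite natr1 ler_nat.
rewrite ger0_norm /lattice_freq; last first.
  by rewrite mulr_ge0 ?exprn_ge0 ?addr_ge0 ?divr_ge0.
rewrite [leRHS]exprSr ler_wpM2l ?exprn_ge0//.
have : 0 <= l%:R :> R by [].
by move: (_ ^- j.+1) al0 al1 => a; rewrite natrM; lra.
Qed.

(** The offset cancels in the difference, and distinct integers are at least 1 apart. *)
Lemma lattice_freq_sep n m (j : 'I_n) (l l' : 'I_m) : l != l' ->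
  ((16 * m)%:R ^+ n.+1) ^+ 2 <= (lattice_freq j l - lattice_freq j l' : R) ^+ 2.
Proof.
move=> ll'; rewrite /lattice_freq -mulrBr exprMn ler_peMr ?sqr_ge0//.
rewrite opprD addrACA subrr addr0.
wlog lt : l l' ll' / (l < l')%N.
  move=> H; have := ll'; rewrite -(inj_eq val_inj) neq_ltn => /orP[h|h];
    first exact: H.
  by rewrite -sqrrN opprB; apply: H; rewrite // eq_sym.
rewrite -sqrrN opprB -natrB ?(ltnW lt)// -natrX ler1n expn_gt0 subn_gt0 lt//.
Qed.

Lemma maximal_estimate_at_packet n m (C s sg : R) : (0 < m)%N -> (0 < n)%N ->
  4 * pi * gau_moment2 <= expR (- 8) / 4 * (m%:R : R) ->
  (forall f : 'rV[R]_n -> R[i], schwartz f ->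
      (L2norm_on (@unit_ball R n) (schrodinger_max f)
         <= C%:E * sobolev_norm s f)%E) ->
  s <= sg -> 0 <= sg <= 1 ->
  ((m%:R * (expR (- 8) / 4)) ^+ n) ^+ 2 * n.+1%:R^-1 ^+ n <=
  C ^+ 2 * (((16 * m)%:R ^+ n.+2) `^ (2 * sg) * (weight_const * m%:R) ^+ n).
Proof.
move=> m0 n0 hm HC ssg sg01.
have L1 : (1 : R) <= (16 * m)%:R by rewrite ler1n muln_gt0.
set X := (X in X <= _); set Y := (X in _ * X).
have X0 : 0 <= X by rewrite mulr_ge0 ?sqr_ge0// exprn_ge0.
have Y0 : 0 <= Y.
  by rewrite mulr_ge0 ?powR_ge0// exprn_ge0// mulr_ge0// mulr_ge0// addr_ge0//
    mulr_ge0// gau_moment2_ge0.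
have f0 := schwartz_tensor_packet (@lattice_freq R n m).
have lam0 : 0 <= (m%:R * (expR (- 8) / 4)) ^+ n :> R.
  by rewrite exprn_ge0// mulr_ge0// divr_ge0// expR_ge0.
have lo := L2norm_on_ball_ge lam0 (fun x => schrodinger_max_ge m0 n0 hm).
have up : (sobolev_norm s (tensor_packet (@lattice_freq R n m)) <= Y%:E `^
  (2^-1))%E.
  apply: (@sobolev_norm_tensor_packet_le _ _ _ _ _ (((16 *
    m)%:R ^+ n.+1) ^+ 2)) => //.
  - by rewrite exprn_ege1.
  - by move=> j l; exact: lattice_freq_norm.
  - by rewrite !exprn_gt0// (lt_le_trans _ L1).
  - rewrite -natrM -!natrX ler_nat -expnM.
    apply: (@leq_trans (16 * m)); first by rewrite leq_mul2r orbT.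
    by rewrite -{1}[(16 * m)%N]expn1 leq_pexp2l// muln_gt0.
  - by move=> j l l'; exact: lattice_freq_sep.
have := le_trans lo (HC _ f0); rewrite -/X => XC.
(* The sign of [C] is unknown; [|C|] makes both sides nonnegative before squaring. *)
have CY : (C%:E * sobolev_norm s (tensor_packet (@lattice_freq R n m)) <=
    `|C|%:E * Y%:E `^ (2^-1))%E.
  apply: (@le_trans _ _ (`|C|%:E * sobolev_norm s (tensor_packet (@lattice_freq R
    n m)))%E).
    by rewrite lee_wpmul2r ?Lnorm_ge0// lee_fin ler_norm.
  by rewrite lee_wpmul2l// lee_fin.
have := le_trans XC CY; rewrite !poweR_EFin -EFinM lee_fin !powR12_sqrt//.
move=> H; have : Num.sqrt X ^+ 2 <= (`|C| * Num.sqrt Y) ^+ 2.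
  by rewrite lerXn2r ?nnegrE ?mulr_ge0 ?sqrtr_ge0.
by rewrite exprMn !sqr_sqrtr// real_normK ?num_real.
Qed.
End counterexample_norm.

(** * Comparison of the powers of [m] *)

Theorem theorem1p2 (R : realType) (n : nat) (hn : (3 <= n)%N) (s : R)
    (hmax : exists C : R, forall f : 'rV[R]_n -> R[i], schwartz f ->
      (L2norm_on (@unit_ball R n) (schrodinger_max f)
         <= C%:E * sobolev_norm s f)%E) :
  n%:R / (2 * (n%:R + 2)) <= s.
Proof.
case: hmax => C HC; rewrite leNgt; apply/negP => hs.
have n0 : (0 < n)%N by exact: leq_trans hn.
have nr : (0 : R) < n%:R by rewrite ltr0n.
(* The Sobolev bound asks for an exponent in [[0, 1]]; since the threshold is positive, [sg] stays
   below it. *)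
pose sg := Num.max s 0.
have sg0 : 0 <= sg by rewrite le_max lexx orbT.
have ssg : s <= sg by rewrite le_max lexx.
have sgn : sg < n%:R / (2 * (n%:R + 2)) by rewrite gt_max hs divr_gt0//
  mulr_gt0// addr_gt0.
have den : 0 < 2 * (n%:R + 2) :> R by rewrite mulr_gt0// addr_gt0.
have sg1 : sg <= 1 by apply/ltW/(lt_trans sgn); rewrite ltr_pdivrMr// mul1r; lra.
(* The power of [m] contributed by [(L^(n+2))^(2 sg)]; [sg] below the threshold means exactly
   [p < n]. *)
pose p := n.+2%:R * (2 * sg).
have pn : p < n%:R.
  by move: sgn; rewrite ltr_pdivlMr// /p -addn2 natrD => h; lra.
pose k : R := expR (- 8) / 4.
have k0 : 0 < k by rewrite divr_gt0 ?expR_gt0.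
pose r : R := n.+1%:R^-1.
have r0 : 0 < r by rewrite invr_gt0 ltr0n.
(* All the factors independent of [m]: after division by [m^n] the estimate reads [m^n <= A m^p]. *)
pose A := C ^+ 2 * (16 `^ p * weight_const ^+ n) / (k ^+ n ^+ 2 * r ^+ n).
have W0 : 0 <= weight_const :> R by rewrite mulr_ge0// addr_ge0// mulr_ge0//
  gau_moment2_ge0.
have kr0 : 0 < k ^+ n ^+ 2 * r ^+ n by rewrite mulr_gt0// !exprn_gt0.
have A0 : 0 <= A.
  by rewrite divr_ge0 ?(ltW kr0)// mulr_ge0 ?sqr_ge0// mulr_ge0 ?powR_ge0//
    exprn_ge0.
(* [m > x1] contradicts [m^(n - p) <= A], and [m > x2] makes the moment term small enough for the
   lower bound. *)
pose x1 := A `^ (n%:R - p)^-1; pose x2 := 4 * pi * gau_moment2 / k.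
have x10 : 0 <= x1 by exact: powR_ge0.
have x20 : 0 <= x2 by rewrite divr_ge0 ?(ltW k0)//
  !mulr_ge0 ?pi_ge0 ?gau_moment2_ge0.
pose m := Num.bound (x1 + x2).
have mx : x1 + x2 < m%:R by apply: archi_boundP; rewrite addr_ge0.
have mr0 : (0 : R) < m%:R by apply: le_lt_trans mx; rewrite addr_ge0.
have m0 : (0 < m)%N by rewrite ltr0n in mr0.
have hm : 4 * pi * gau_moment2 <= k * m%:R.
  rewrite -ler_pdivrMl// mulrC -/x2; apply/ltW/(le_lt_trans _ mx).
  by rewrite lerDr.
have := maximal_estimate_at_packet m0 n0 hm HC ssg _; rewrite sg0 sg1 => /(_ isT).
rewrite -/k -/r -(powR_mulrn n.+2 (ler0n R (16 * m))) -powRrM -/p natrM powRM//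
  => H.
have mA : m%:R ^+ n <= A * m%:R `^ p.
  rewrite /A mulrAC ler_pdivlMr// -(ler_pM2l (exprn_gt0 n mr0)).
  move: H; rewrite !exprMn.
  congr (_ <= _); ring.
have : m%:R `^ (n%:R - p) <= A.
  rewrite powRB ?gt_eqF// powR_mulrn ?(ltW mr0)// ler_pdivrMr ?powR_gt0//.
apply/negP; rewrite -ltNge.
have np : 0 < n%:R - p by rewrite subr_gt0.
rewrite (_ : A = x1 `^ (n%:R - p)); last by rewrite /x1 -powRrM mulVf ?gt_eqF//
  powRr1.
apply: gt0_ltr_powR; rewrite ?nnegrE// ?(ltW mr0)//.
by apply: le_lt_trans mx; rewrite lerDl.
Qed.
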